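(* Let $G$ be an abelian group satisfying $1\le r_d(G)<\omega$. The following conditions are equivalent: (i) $G$ admits an SSGP topology; (ii) $G$ admits an $\mathtt{SSGP}(\alpha)$ topology for some ordinal $\alpha$; (iii) the quotient $H=G/t(G)$ of $G$ by its torsion part $t(G)$ has finite rank $r_0(H)$, and $r(H/A)=\omega$ for some (equivalently, every) free subgroup $A$ of $H$ such that $H/A$ is torsion.
   Context: Abelian groups are written additively. $\mathbb{N}^+$ is the set of positive integers, $\mathbf{P}$ the set of prime numbers, and $\omega$ the first infinite cardinal. For an abelian group $G$: $t(G)$ is the torsion subgroup; $r_0(G)$ is the free (torsion-free) rank; for a prime $p$, $r_p(G)$ is the $p$-rank (the dimension over $\mathbb{Z}/p\mathbb{Z}$ of $\{x\in G: px=0\}$); $$r(G)=\max\Big\{r_0(G),\ \sum\{r_p(G):p\in\mathbf{P}\}\Big\}.$$ The divisible rank of $G$ is the cardinal $r_d(G)=\min\{r(nG):n\in\mathbb{N}^+\}$. For a subset $A$ of a group $G$, $\langle A\rangle$ is the smallest subgroup of $G$ containing $A$, $\langle x\rangle=\langle\{x\}\rangle$, and $\mathrm{Cyc}(A)=\{x\in G:\langle x\rangle\subseteq A\}$. A topological group $G$ is SSGP (has the small subgroup generating property) if $\langle \mathrm{Cyc}(U)\rangle$ is dense in $G$ for every neighbourhood $U$ of the identity. All topological groups are assumed Hausdorff. For abelian topological groups, the property $\mathtt{SSGP}(\alpha)$ is defined by transfinite recursion on the ordinal $\alpha$: only the trivial group has $\mathtt{SSGP}(0)$; for $\alpha>0$,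 $G$ has $\mathtt{SSGP}(\alpha)$ if for every neighbourhood $U$ of $0$ in $G$ there is an ordinal $\beta<\alpha$ such that the quotient topological group $G/\overline{\langle \mathrm{Cyc}(U)\rangle}$ has $\mathtt{SSGP}(\beta)$ (the bar denotes closure in $G$). In particular $\mathtt{SSGP}(1)$ coincides with SSGP. A group $G$ admits an SSGP topology (respectively, an $\mathtt{SSGP}(\alpha)$ topology) if there is a (Hausdorff) topology on $G$ making it a topological group with the property SSGP (respectively, $\mathtt{SSGP}(\alpha)$). *)

(* Defs.v *)
From HB Require Import structures.
From mathcomp Require Import all_boot all_order all_algebra.
From mathcomp Require Import all_classical topology tvs.
From mathcomp Require wochoice.

Set Implicit Arguments.
Unset Strict Implicit.
Unset Printing Implicit Defensive.

Import GRing.Theory.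

Local Open Scope classical_set_scope.
Local Open Scope card_scope.
Local Open Scope ring_scope.
Local Open Scope quotient_scope.

Section Subgroups.
Variable G : zmodType.
Implicit Types A B S : set G.

Definition span A : set G := smallest [set B : set G | zmod_closed (mem B)] A.

Definition Cyc A : set G := [set x | span [set x] `<=` A].

(* Linear independence with coefficients in Z / dZ; for d = 0, in Z. *)
Definition independent (d : nat) B : Prop :=
  forall (s : seq G) (c : G -> int), uniq s -> [set` s] `<=` B ->
    \sum_(x <- s) x *~ c x = 0 -> {in s, forall x, (d %| c x)%Z}.

Definition free_subgroup A : Prop :=
  exists B, independent 0 B /\ span B = A.

Definition torsion : {pred G} :=
  fun x => `[< exists2 n, (0 < n)%N & x *+ n = 0 >].

Lemma torsion_zmod_closed : zmod_closed torsion.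
Proof.
split; first by apply/asboolP; exists 1%N; rewrite ?mul0rn.
move=> x y /asboolP[m m0 xm] /asboolP[n n0 yn]; apply/asboolP.
exists (m * n)%N; first by rewrite muln_gt0 m0.
by rewrite mulrnBl mulrnA xm mulnC mulrnA yn !mul0rn subrr.
Qed.

HB.instance Definition _ := GRing.isZmodClosed.Build G torsion torsion_zmod_closed.

Lemma span_zmod_closed A : zmod_closed (mem (span A)).
Proof.
split; first by rewrite inE => B [] [B0 _] _; rewrite -in_setE.
move=> x y; rewrite !inE => Ax Ay B BA; have [[_ BB] _] := BA.
by rewrite -in_setE; apply: BB; rewrite inE; [exact: Ax|exact: Ay].
Qed.

End Subgroups.
Arguments torsion G : clear implicits.

(* A cardinal is represented by a set of that cardinality, to be compared with *)
(* others by means of #<= and #= only. Below, xget chooses a maximal           *)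
(* independent set, a basis, or an index realizing a minimum of cardinals; all *)
(* of these exist, so that the default value of xget is never used.            *)

Definition card_max T U (A : set T) (B : set U) : set (T + U) :=
  if A #<= B then inr @` B else inl @` A.

Section Ranks.
Variable G : zmodType.
(* S stands for (the carrier of) a subgroup of G. *)
Implicit Types B S : set G.

Definition maximal_independent S B : Prop :=
  [/\ B `<=` S, independent 0 B &
      forall C, B `<=` C -> C `<=` S -> independent 0 C -> C = B].

Definition free_rank S : set G := xget set0 (maximal_independent S).

(* B is a basis of the Z / pZ-vector space S[p]. *)
Definition p_basis (p : nat) S B : Prop :=
  independent p B /\ span B = S `&` [set x | x *+ p = 0].

Definition p_rank (p : nat) S : set G := xget set0 (p_basis p S).

Definition sum_p_rank S : set (nat * G) :=
  [set px | prime px.1 /\ p_rank px.1 S px.2].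

Definition rank S : set (G + nat * G) := card_max (free_rank S) (sum_p_rank S).

Definition multiples (n : nat) : set G := range (fun x => x *+ n).

Definition divisible_rank : set (G + nat * G) :=
  rank (multiples (xget 1%N [set n | (0 < n)%N /\
    forall m, (0 < m)%N -> rank (multiples n) #<= rank (multiples m)])).

End Ranks.
Arguments multiples G n : clear implicits.
Arguments divisible_rank G : clear implicits.

(* Group topologies on a given group. The alias retopologize lets G carry a    *)
(* topology tau that is not canonically attached to it.                        *)

Definition retopologize (G : zmodType) (tau : isOpenTopological G) : Type := G.

HB.instance Definition _ (G : zmodType) (tau : isOpenTopological G) :=
  GRing.Zmodule.copy (retopologize tau) G.
HB.instance Definition _ (G : zmodType) (tau : isOpenTopological G) :=
  (tau : isOpenTopological (retopologize tau)).

Record group_topology (G : zmodType) := GroupTopology {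
  group_topology_open :> isOpenTopological G;
  group_topology_add :
    continuous (fun x : retopologize group_topology_open *
                        retopologize group_topology_open => x.1 + x.2);
  group_topology_opp :
    continuous (-%R : retopologize group_topology_open -> _);
  group_topology_hausdorff : hausdorff_space (retopologize group_topology_open)
}.

Definition topologized (G : zmodType) (tau : group_topology G) : Type :=
  retopologize tau.

HB.instance Definition _ (G : zmodType) (tau : group_topology G) :=
  Topological.copy (topologized tau) (retopologize tau).
HB.instance Definition _ (G : zmodType) (tau : group_topology G) :=
  GRing.Zmodule.copy (topologized tau) (retopologize tau).
HB.instance Definition _ (G : zmodType) (tau : group_topology G) :=
  PreTopologicalNmodule_isTopologicalNmodule.Build (topologized tau)
    (@group_topology_add G tau).
HB.instance Definition _ (G : zmodType) (tau : group_topology G) :=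
  TopologicalNmodule_isTopologicalZmodule.Build (topologized tau)
    (@group_topology_opp G tau).

Section QuotientGroup.
Variables (G : topologicalZmodType) (N : zmodClosed G).

Definition topquot : Type := quotient_topology (Quotient.quot N).

HB.instance Definition _ := Topological.on topquot.
HB.instance Definition _ := Quotient.on topquot.
HB.instance Definition _ := GRing.isZmodule.Build topquot
  (@Quotient.addqA G N) (@Quotient.addqC G N)
  (@Quotient.add0q G N) (@Quotient.addNq G N).
Local Notation pi := (\pi_topquot : G -> topquot).

Let piD x y : pi (x + y) = pi x + pi y.
Proof. exact: (@Quotient.pi_add G N). Qed.

Let piN x : pi (- x) = - pi x.
Proof. exact: (@Quotient.pi_opp G N). Qed.

Let pi_eqP x y : reflect (pi x = pi y) (x - y \in N).
Proof.
rewrite (Quotient.idealrBE N x y).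
exact: (@eqP {ideal_quot N} (\pi x) (\pi y)).
Qed.

Lemma topquot_open_pi (B : set G) : open B -> open (pi @` B).
Proof.
move=> oB; suff : open (pi @^-1` (pi @` B)) by [].
have -> : pi @^-1` (pi @` B) = \bigcup_(n in [set` N]) ((+%R^~ n) @^-1` B).
  apply/seteqP; split=> x /=.
    move=> [b Bb] /pi_eqP bxN; exists (b - x) => //=.
    by rewrite addrC subrK.
  move=> [n /= nN Bxn]; exists (x + n) => //; apply/pi_eqP.
  by rewrite addrAC subrr add0r.
apply: bigcup_open => n _; apply: open_comp => // x _.
apply: (@continuous_comp _ _ _ (fun z => (z, n)) (fun z : G * G => z.1 + z.2)).
  by apply: cvg_pair; [exact: cvg_id|exact: cvg_cst].
exact: add_continuous.
Qed.

Lemma topquot_nbhs_pi x (A : set G) : nbhs x A -> nbhs (pi x) (pi @` A).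
Proof.
rewrite nbhsE => -[B [oB Bx] BA]; rewrite nbhsE.
exists (pi @` B); last exact: image_subset.
by split; [exact: topquot_open_pi|exists x].
Qed.

Lemma topquot_add_continuous :
  continuous (fun x : topquot * topquot => x.1 + x.2).
Proof.
move=> [p q]; rewrite -[p]reprK -[q]reprK.
move: (repr p) (repr q) => {p q} x y U /=; rewrite -piD => Uxy.
have /(add_continuous (x, y))[[V W] /= [Vx Wy] VW] :
  nbhs (x + y) (pi @^-1` U) by exact: (@pi_continuous G _ (x + y)).
exists (pi @` V, pi @` W); first by split; exact: topquot_nbhs_pi.
by move=> [_ _] /= [[v Vv <-] [w Ww <-]]; rewrite -piD; exact: (VW (v, w)).
Qed.

Lemma topquot_opp_continuous : continuous (-%R : topquot -> topquot).
Proof.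
move=> p; rewrite -[p]reprK; move: (repr p) => {p} x U /=; rewrite -piN => Ux.
have /(opp_continuous x) Vx : nbhs (- x) (pi @^-1` U).
  exact: (@pi_continuous G _ (- x)).
apply: filterS (topquot_nbhs_pi Vx) => _ [y /= Uy <-].
by rewrite /= -piN.
Qed.

HB.instance Definition _ :=
  PreTopologicalNmodule_isTopologicalNmodule.Build topquot topquot_add_continuous.
HB.instance Definition _ :=
  TopologicalNmodule_isTopologicalZmodule.Build topquot topquot_opp_continuous.

End QuotientGroup.

Section SSGP.
Variable G : topologicalZmodType.

Definition cyc_kernel (U : set G) : {pred G} := mem (closure (span (Cyc U))).

Lemma cyc_kernel_zmod_closed U : zmod_closed (cyc_kernel U).
Proof.
have [S0 SB] := span_zmod_closed (Cyc U).
split; first by rewrite inE; apply: subset_closure; rewrite -in_setE.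
move=> x y; rewrite !inE => xS yS B /(@sub_continuous G (x, y))[[V W]] /=.
move=> [/xS[v [Sv Vv]] /yS[w [Sw Ww]]] VW.
exists (v - w); split; last exact: (VW (v, w)).
by rewrite -in_setE; apply: SB; rewrite inE.
Qed.

HB.instance Definition _ U :=
  GRing.isZmodClosed.Build G (cyc_kernel U) (cyc_kernel_zmod_closed U).

Definition SSGP : Prop := forall U, nbhs (0 : G) U -> dense (span (Cyc U)).

End SSGP.

(* An ordinal is represented by a well-ordered type of that order type; by     *)
(* definition, beta < alpha when beta is isomorphic to a proper initial        *)
(* segment of alpha.                                                           *)

Record ord := Ord {
  ord_sort :> Type;
  ord_le : rel ord_sort;
  ord_wo : wochoice.well_order ord_le
}.

Definition ord_lt (beta alpha : ord) : Prop :=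
  exists2 f : beta -> alpha,
    forall x y, ord_le (f x) (f y) = ord_le x y &
    exists a, range f = [set b | ord_le b a /\ b <> a].

Inductive SSGP_ord (alpha : ord) (G : topologicalZmodType) : Prop :=
| SSGP_ord_zero :
    ~ inhabited alpha -> (forall x : G, x = 0) -> SSGP_ord alpha G
| SSGP_ord_pos :
    inhabited alpha ->
    (forall U, nbhs (0 : G) U ->
       exists beta, ord_lt beta alpha /\ SSGP_ord beta (topquot (cyc_kernel U))) ->
    SSGP_ord alpha G.

Definition admits_SSGP (G : zmodType) : Prop :=
  exists tau : group_topology G, SSGP (topologized tau).

Definition admits_SSGP_ord (alpha : ord) (G : zmodType) : Prop :=
  exists tau : group_topology G, SSGP_ord alpha (topologized tau).

Definition is_torsion (G : zmodType) : Prop := forall x : G, x \in torsion G.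

(* Main.v *)
(** Let [n] realize the divisible rank, so that [nG] has finite rank, and let [H]
    be [G] modulo torsion.  Say that a group has finite socles when each of its
    quotients has only finitely many elements of prime order.  This property
    passes to quotients and extensions, and holds for finitely generated groups
    and for torsion groups of finite rank; (iii) amounts to the statement that
    [H] does not have finite socles, which does not involve the subgroup [A].

    Necessity.  If [H] has finite socles, so does [Q = G/G[n]], a copy of [nG].
    A group [Q] of finite rank with finite socles that is a continuous image of
    an SSGP(alpha) group is indiscrete.  By induction on [alpha], [<Cyc U>] is
    dense in [Q] for each neighbourhood [U] of [0].  Choose a finitely generated
    subgroup [B] of maximal rank inside a small [V], and let [C] be its closure.
    Elements of [Cyc W] for small [W] are torsion modulo [C], and vanish there as
    soon as [W] avoids the finite socle of [Q/C]; so [Q = C] lies in the closure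
    of [V].  As [Q] is indiscrete, [G[n]] is dense, whence [nG = 0], which is
    excluded by [1 <= r_d(G)].

    Sufficiency.  [G] is the direct sum of a countable group containing [nG] and
    of homogeneous groups, each a sum of infinitely many copies of some [Z/q].
    On each summand a Hausdorff group topology is built in which every element
    of a generating set is, for arbitrarily large [k], the sum of [2^k] elements
    with cyclic subgroups of size [2^-k] and of an error of size [2^-k].  In a
    homogeneous group these elements are new members of a basis.  In the
    countable group they are [2^k z] where [z] has a new prime order modulo a
    free subgroup of maximal rank; infinitely many primes are available by
    (iii). *)
Require Import Defs.
From HB Require Import structures.
From mathcomp Require Import all_boot all_order all_algebra.
From mathcomp Require Import all_classical topology tvs.
From mathcomp Require Import zify.
From mathcomp Require wochoice.
Import Defs.

Set Implicit Arguments.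
Unset Strict Implicit.
Unset Printing Implicit Defensive.

Import Order.TTheory GRing.Theory Num.Theory.

Local Open Scope classical_set_scope.
Local Open Scope card_scope.
Local Open Scope ring_scope.

(** * Subgroups, spans and independence *)

Section Subgroup.
Variable G : zmodType.
Implicit Types (A B S : set G) (x y z : G).

Definition subgroup A : Prop := A 0 /\ forall x y, A x -> A y -> A (x - y).

Lemma subgroup_zmod_closed A : subgroup A <-> zmod_closed (mem A).
Proof.
split=> -[A0 AB]; split; rewrite ?inE // in A0 *; last first.
  by move=> x y; have := AB x y; rewrite !inE.
by move=> x y; rewrite !inE; exact: AB.
Qed.

Section Closure.
Variable A : set G.
Hypothesis sA : subgroup A.

Lemma subgroup0 : A 0. Proof. by case: sA. Qed.

Lemma subgroupB x y : A x -> A y -> A (x - y). Proof. by case: sA => _; exact. Qed.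

Lemma subgroupN x : A x -> A (- x).
Proof. by rewrite -(sub0r x); apply: subgroupB; exact: subgroup0. Qed.

Lemma subgroupD x y : A x -> A y -> A (x + y).
Proof. by move=> Ax Ay; rewrite -(opprK y); apply: subgroupB => //; exact: subgroupN. Qed.

Lemma subgroupDr x y : A y -> A (x + y) -> A x.
Proof. by move=> Ay Axy; rewrite -(addrK y x); exact: subgroupB. Qed.

Lemma subgroupMn x n : A x -> A (x *+ n).
Proof.
move=> Ax; elim: n => [|n IHn]; first by rewrite mulr0n; exact: subgroup0.
by rewrite mulrSr; exact: subgroupD.
Qed.

Lemma subgroupMz x (n : int) : A x -> A (x *~ n).
Proof.
by move=> Ax; case: n => n; [exact: subgroupMn|apply: subgroupN; exact: subgroupMn].
Qed.

Lemma subgroup_sum (I : eqType) (r : seq I) (f : I -> G) :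
  (forall i, i \in r -> A (f i)) -> A (\sum_(i <- r) f i).
Proof.
move=> Af; rewrite big_seq; elim/big_ind: _ => //; first exact: subgroup0.
exact: subgroupD.
Qed.

End Closure.

Lemma subgroup_span A : subgroup (span A).
Proof. by apply/subgroup_zmod_closed; exact: span_zmod_closed. Qed.

Lemma sub_span A : A `<=` span A.
Proof. exact: sub_gen_smallest. Qed.

Lemma span_min A B : subgroup B -> A `<=` B -> span A `<=` B.
Proof. by move=> /subgroup_zmod_closed sB AB; exact: smallest_sub. Qed.

Lemma spanS A B : A `<=` B -> span A `<=` span B.
Proof.
by move=> AB; apply: span_min; [exact: subgroup_span|apply: subset_trans AB _; exact: sub_span].
Qed.

Lemma subgroup_set0 : subgroup [set 0].
Proof. by split => // x y -> ->; rewrite subrr. Qed.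

Lemma subgroup_setT : subgroup setT. Proof. by []. Qed.

Lemma subgroupI A B : subgroup A -> subgroup B -> subgroup (A `&` B).
Proof.
move=> sA sB; split; first by split; exact: subgroup0.
by move=> x y [Ax Bx] [Ay By]; split; exact: subgroupB.
Qed.

Lemma subgroup_zmodClosed (N : zmodClosed G) : subgroup [set` N].
Proof. by split=> [|x y]; rewrite /= ?rpred0 // => xN yN; rewrite rpredB. Qed.

Definition setadd A B : set G := [set z | exists x y, [/\ A x, B y & z = x + y]].

Lemma subgroup_setadd A B : subgroup A -> subgroup B -> subgroup (setadd A B).
Proof.
move=> sA sB; split.
  by exists 0, 0; split; [exact: subgroup0 sA|exact: subgroup0 sB|rewrite addr0].
move=> _ _ [x [y [Ax By ->]]] [x' [y' [Ax' By' ->]]].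
exists (x - x'), (y - y'); split; [exact: subgroupB|exact: subgroupB|].
by rewrite opprD addrACA.
Qed.

Lemma setadd_subl A B : B 0 -> A `<=` setadd A B.
Proof. by move=> B0 x Ax; exists x, 0; rewrite addr0. Qed.

Lemma setadd_subr A B : A 0 -> B `<=` setadd A B.
Proof. by move=> A0 x Bx; exists 0, x; rewrite add0r. Qed.

Lemma span1P x y : span [set x] y <-> exists k : int, y = x *~ k.
Proof.
split=> [|[k ->]]; last first.
  by apply: (subgroupMz (subgroup_span _)); exact: sub_span.
move: y; apply: span_min; last by move=> _ ->; exists 1; rewrite mulr1z.
split; first by exists 0; rewrite mulr0z.
by move=> _ _ [k ->] [l ->]; exists (k - l); rewrite mulrzBr.
Qed.

Lemma CycP A x : Cyc A x <-> forall k : int, A (x *~ k).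
Proof.
split=> [Ax k|Ax y /span1P[k ->] //]; apply: Ax; apply/span1P; by exists k.
Qed.

End Subgroup.

Lemma subgroup_preimage (G G' : zmodType) (f : {additive G -> G'}) (A : set G') :
  subgroup A -> subgroup (f @^-1` A).
Proof.
move=> sA; split=> [|x y]; rewrite /preimage /= ?raddf0; first exact: subgroup0.
by move=> Ax Ay; rewrite raddfB; exact: subgroupB.
Qed.

Lemma subgroup_image (G G' : zmodType) (f : {additive G -> G'}) (A : set G) :
  subgroup A -> subgroup (f @` A).
Proof.
move=> sA; split; first by exists 0; [exact: subgroup0|rewrite raddf0].
move=> _ _ [x Ax <-] [y Ay <-]; exists (x - y); rewrite ?raddfB //; exact: subgroupB.
Qed.

(** * Linear combinations of indexed families *)

Section Families.
Variables (G : zmodType) (I : eqType) (f : I -> G).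
Implicit Types (D : set I) (s : seq I) (c : I -> int) (N : set G).

Definition lincomb s c : G := \sum_(i <- s) f i *~ c i.

(** For members killed by [d], this also says that their span meets the subgroup [N] only in zero.
    The family is indexed so that repeated values count as dependent when [d] is not [1]. *)
Definition indep_mod N (d : nat) D : Prop :=
  forall s c, uniq s -> [set` s] `<=` D -> N (lincomb s c) ->
    {in s, forall i, (d %| c i)%Z}.

Lemma lincomb_span D s c : [set` s] `<=` D -> span (f @` D) (lincomb s c).
Proof.
move=> sD; apply: (subgroup_sum (subgroup_span _)) => i si.
apply: (subgroupMz (subgroup_span _)).
by apply: sub_span; exists i => //; exact: sD.
Qed.

Lemma lincomb_ext s t c : uniq s -> uniq t -> {subset s <= t} ->
  lincomb s c = lincomb t (fun i => if i \in s then c i else 0).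
Proof.
move=> us ut st; rewrite /lincomb [RHS](bigID (mem s)) /= [X in _ = _ + X]big1 ?addr0.
  under [RHS]eq_bigr => i -> do [].
  rewrite -[RHS]big_filter; apply: perm_big; apply: uniq_perm => //; first exact: filter_uniq.
  by move=> i; rewrite mem_filter; case: (boolP (i \in s)) => //= /st ->.
by move=> i /negbTE ->; rewrite mulr0z.
Qed.

Lemma spanP D x : span (f @` D) x ->
  exists s c, [/\ uniq s, [set` s] `<=` D & x = lincomb s c].
Proof.
move: x; apply: span_min.
  split; first by exists [::], (fun=> 0); split => //; rewrite /lincomb big_nil.
  move=> _ _ [s [c [us sD ->]]] [t [e [ut tD ->]]].
  exists (undup (s ++ t)), (fun i => (if i \in s then c i else 0) - (if i \in t then e i else 0)).
  split; first exact: undup_uniq.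
    by move=> i /=; rewrite mem_undup mem_cat => /orP[/sD|/tD].
  rewrite (@lincomb_ext s (undup (s ++ t))) ?undup_uniq //; last first.
    by move=> i si; rewrite mem_undup mem_cat si.
  rewrite (@lincomb_ext t (undup (s ++ t))) ?undup_uniq //; last first.
    by move=> i si; rewrite mem_undup mem_cat si orbT.
  by rewrite /lincomb -sumrB; apply: eq_bigr => i _; rewrite mulrzBr.
move=> _ [i Di <-]; exists [:: i], (fun=> 1); split => //.
  by move=> j /=; rewrite inE => /eqP ->.
by rewrite /lincomb big_seq1.
Qed.

Lemma spanP_on s x : uniq s -> span (f @` [set` s]) x -> exists c, x = lincomb s c.
Proof.
move=> us /spanP[t [c [ut ts ->]]].
exists (fun i => if i \in t then c i else 0); apply: lincomb_ext => //.
Qed.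

End Families.

Lemma independentE (G : zmodType) d (B : set G) :
  independent d B <-> indep_mod id [set 0] d B.
Proof. by split=> iB s c; exact: iB. Qed.

Lemma lincombB (G : zmodType) (I : eqType) (f : I -> G) s c c' :
  lincomb f s c - lincomb f s c' = lincomb f s (fun i => c i - c' i).
Proof. by rewrite /lincomb -sumrB; apply: eq_bigr => i _; rewrite mulrzBr. Qed.

Lemma lincombMz (G : zmodType) (I : eqType) (f : I -> G) s c k :
  lincomb f s c *~ k = lincomb f s (fun i => c i * k).
Proof.
rewrite /lincomb mulrz_suml; apply: eq_bigr => i _; by rewrite mulrzA.
Qed.

Lemma lincomb_cat (G : zmodType) (I : eqType) (f : I -> G) s t c :
  lincomb f (s ++ t) c = lincomb f s c + lincomb f t c.
Proof. by rewrite /lincomb big_cat. Qed.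

(** Expanding [x] over members outside [s] and merging the two coefficient functions gives a single
    relation in [N]. *)
Lemma indep_mod_span (G : zmodType) (I : eqType) (f : I -> G) D d N s c x :
  subgroup N -> indep_mod f N d D -> uniq s -> [set` s] `<=` D ->
  span (f @` [set i | D i /\ i \notin s]) x -> N (lincomb f s c + x) ->
  {in s, forall i, (d %| c i)%Z}.
Proof.
move=> sN iD us sD /spanP[t [e [ut tD ->]]] Nx i si.
have st j : j \in t -> j \notin s by move=> /tD[].
have := iD (s ++ t) (fun j => if j \in s then c j else e j).
rewrite cat_uniq us ut andbT.
have -> : ~~ has (in_mem^~ (mem s)) t by apply/hasPn => j /st.
move=> /(_ isT _ _ i); rewrite mem_cat si /=; apply => //.
  by move=> j /=; rewrite mem_cat => /orP[/sD|/tD[]].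
suff -> : lincomb f (s ++ t) (fun j => if j \in s then c j else e j) = lincomb f s c + lincomb f t e by [].
rewrite lincomb_cat /lincomb; congr (_ + _); apply: eq_big_seq => j; first by move=> ->.
by move=> /st /negbTE ->.
Qed.

(** * Ranks *)

(** With more rows than columns, the rational left kernel is nonzero for reasons of rank;
    denominators are then cleared. *)
Lemma int_kernel (m n : nat) (M : 'I_m -> 'I_n -> int) : (n < m)%N ->
  exists2 v : 'I_m -> int, exists i, v i != 0 &
    forall j, \sum_i M i j * v i = 0.
Proof.
move=> nm; pose A := \matrix_(i, j) (M i j)%:~R : 'M[rat]_(m, n).
have : kermx A != 0.
  rewrite kermx_eq0 /row_free neq_ltn (leq_ltn_trans (rank_leq_col A)) //.
case/rowV0Pn=> u /sub_kermxP uA /rV0Pn[i0 ui0].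
(* This is [u 0 i] times the product of all denominators; [numq] has absorbed the factor
   [denq (u 0 i)]. *)
pose w i := numq (u 0 i) * \prod_(j | j != i) denq (u 0 j).
have wE i : (w i)%:~R = u 0 i * (\prod_j denq (u 0 j))%:~R :> rat.
  by rewrite /w intrM [in RHS](bigD1 i) //= intrM mulrA numqE.
exists w => [|j].
  exists i0; rewrite -(intr_eq0 rat) wE mulf_neq0 // intr_eq0.
  by apply/prodf_neq0 => j _; exact: denq_neq0.
apply/eqP; rewrite -(intr_eq0 rat) raddf_sum /=.
have /matrixP/(_ 0 j) := uA; rewrite !mxE => uAj.
transitivity ((\sum_i u 0 i * A i j) * (\prod_j denq (u 0 j))%:~R == 0); last first.
  by rewrite uAj mul0r eqxx.
congr (_ == _); rewrite mulr_suml; apply: eq_bigr => i _.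
by rewrite intrM wE !mxE mulrA [_%:~R * _]mulrC.
Qed.

Lemma countable_image T U (f : T -> U) (A : set T) :
  countable A -> countable (f @` A).
Proof. exact: sub_countable (card_image_le f A). Qed.

(** Through this lemma, finitary conditions such as independence pass to unions of chains, as Zorn's
    lemma requires. The empty case is apart because the chain itself may be empty. *)
Lemma chain_finite T (F : set (set T)) (s : seq T) : total_on F subset ->
  (forall x, List.In x s -> (\bigcup_(X in F) X) x) ->
  s = [::] \/ exists2 X, F X & forall x, List.In x s -> X x.
Proof.
move=> tF; elim: s => [|x s IHs] sF; [by left|right].
have [Y FY Yx] : (\bigcup_(X in F) X) x by apply: sF; left.
have [|->|[X FX Xs]] := IHs; first by move=> y sy; apply: sF; right.
  by exists Y => // y [<-|[]].
have [XY|YX] := tF X Y FX FY.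
  by exists Y => // y [<- //|/Xs /XY].
by exists X => // y [<-|/Xs //]; exact: YX.
Qed.

Lemma InE (T : eqType) (x : T) (s : seq T) : List.In x s <-> x \in s.
Proof.
elim: s => //= y s IHs; rewrite inE; split.
  by move=> [->|/IHs ->]; rewrite ?eqxx ?orbT.
by move=> /predU1P[->|/IHs]; [left|right].
Qed.

Lemma finite_fibers T U (A : set T) (B : set U) (f : T -> U) : finite_set B ->
  f @` A `<=` B -> (forall y, B y -> finite_set (A `&` f @^-1` [set y])) ->
  finite_set A.
Proof.
move=> fB AB fF; apply: (@sub_finite_set _ _ (\bigcup_(y in B) (A `&` f @^-1` [set y]))).
  by move=> x Ax; exists (f x) => //; apply: AB; exists x.
exact: bigcup_finite.
Qed.

Section Ranks.
Variable G : zmodType.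
Implicit Types (A B S : set G) (x y z : G) (b s : seq G).

Definition torsion_mod B x : Prop := exists2 k, (0 < k)%N & B (x *+ k).

(** Exchange argument over the integers: a positive multiple of each member of [s] is a combination
    of [b], so more than [size b] members would satisfy a nontrivial relation by [int_kernel]. *)
Lemma indep_size b s : uniq s -> independent 0 [set` s] ->
  (forall x, x \in s -> torsion_mod (span [set` b]) x) -> (size s <= size b)%N.
Proof.
move=> us /independentE iS sb; rewrite leqNgt; apply/negP => bs.
have {bs} : (size (undup b) < size s)%N by exact: leq_ltn_trans (size_undup b) bs.
set t := undup b => ts.
have {}sb (i : 'I_(size s)) : exists kc : nat * (G -> int),
    (0 < kc.1)%N /\ s`_i *+ kc.1 = lincomb id t kc.2.
  have [k k0 sk] := sb s`_i (mem_nth 0 (ltn_ord i)).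
  have : span (id @` [set` t]) (s`_i *+ k).
    by rewrite image_id; apply: spanS sk => x /=; rewrite mem_undup.
  case/(spanP_on (undup_uniq b)) => c cE; by exists (k, c).
have [kc kcP] := choice sb.
have [v [i0 vi0] vM] := @int_kernel _ _ (fun i (j : 'I_(size t)) => (kc i).2 t`_j) ts.
pose c x := if insub (index x s) is Some i then (kc i).1%:Z * v i else 0.
have cE (i : 'I_(size s)) : c s`_i = (kc i).1%:Z * v i.
  by rewrite /c index_uniq // valK.
have /iS /(_ s`_i0 (mem_nth 0 (ltn_ord i0))) : lincomb id s c = 0.
  rewrite /lincomb (big_nth 0) big_mkord.
  transitivity (\sum_(i < size s) \sum_(j < size t) t`_j *~ ((kc i).2 t`_j * v i)).
    apply: eq_bigr => i _; rewrite cE mulrzA -pmulrn (proj2 (kcP i)) lincombMz.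
    by rewrite /lincomb (big_nth 0) big_mkord.
  rewrite exchange_big big1 // => j _; by rewrite -mulrz_sumr vM mulr0z.
rewrite cE => /(_ us (@subset_refl _ _)); rewrite dvd0z mulf_eq0 (negbTE vi0) orbF.
by have [k0 _] := kcP i0; rewrite eqz_nat eqn0Ngt k0.
Qed.

Lemma indep_finite b S : independent 0 S ->
  (forall x, S x -> torsion_mod (span [set` b]) x) -> finite_set S.
Proof.
move=> iS Sb; apply: contrapT => /(infinite_set_fset (size b).+1)[X XS sX].
suff : (size (finmap.enum_fset X) <= size b)%N by move: sX; lia.
apply: indep_size (finmap.fset_uniq X) _ _ => [s c us sX0|x xX]; last by apply: Sb; exact: XS.
by apply: iS us _ => x xs; apply: XS; exact: sX0.
Qed.

Lemma ex_max_indep d S : exists B, [/\ B `<=` S, independent d B &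
  forall C, B `<=` C -> C `<=` S -> independent d C -> C = B].
Proof.
have [|B [[BS iB] maxB]] := @Zorn_bigcup G (fun B => B `<=` S /\ independent d B).
  move=> F FP tF; split; first by move=> x [X /FP[XS _] /XS].
  move=> s c us sF; have [|->//|[X FX Xs]] := @chain_finite _ F s tF.
    by move=> x /InE; exact: sF.
  have [_ iX] := FP _ FX; apply: iX us _ => x /InE; exact: Xs.
exists B; split => // C BC CS iC; apply: contrapT => CB.
by apply: (maxB C) => //; split => // CB'; apply: CB; apply/seteqP; split.
Qed.

(** The condition on [x] covers two uses: for [d = 0], only the coefficient zero brings [x] into the
    span; for a prime [d] that kills [x], only the multiples of [d] do. *)
Lemma indepU1 d B x : independent d B ->
  (forall k : int, span B (x *~ k) -> x *~ k = 0 /\ (d %| k)%Z) ->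
  independent d (x |` B).
Proof.
move=> iB xB s c us sxB.
have [xs|xs] := boolP (x \in s); last first.
  by apply: iB us _ => y ys; have [yx|//] := sxB _ ys; rewrite -yx ys in xs.
have rB : [set` rem x s] `<=` B.
  by move=> y; rewrite /= mem_rem_uniq // inE => /andP[/eqP yx /sxB[]].
rewrite (big_rem x) //= => /eqP; rewrite addr_eq0 => /eqP xE.
have [x0 dx] : x *~ c x = 0 /\ (d %| c x)%Z.
  apply: xB; rewrite xE; apply: (subgroupN (subgroup_span _)).
  by have := @lincomb_span _ _ id _ _ c rB; rewrite image_id.
move: xE; rewrite x0 => /eqP; rewrite eq_sym oppr_eq0 => /eqP /iB ir y ys.
have [->//|yx] := eqVneq y x; apply: ir => //; first exact: rem_uniq.
by rewrite mem_rem_uniq // inE yx.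
Qed.

Lemma max_indep_torsion S B : maximal_independent S B ->
  forall x, S x -> torsion_mod (span B) x.
Proof.
move=> [BS iB maxB] x Sx; apply: contrapT => xB.
have Bx : ~ B x by move=> Bx; apply: xB; exists 1%N => //; exact: sub_span.
apply: Bx; rewrite -(maxB (x |` B)); [by left|by move=> y; right| |].
  by move=> y [->//|/BS].
apply: indepU1 => // k xk; suff -> : k = 0 by rewrite mulr0z.
apply: contrapT => /eqP k0; apply: xB.
exists `|k|%N; first by rewrite absz_gt0.
rewrite pmulrn abszEsign mulrzA mulrzAC.
by apply: (subgroupMz (subgroup_span _)).
Qed.

Lemma max_indep_finite S B : maximal_independent S B -> finite_set B ->
  exists b, [/\ uniq b, B = [set` b] & independent 0 [set` b]].
Proof.
move=> [_ iB _] /finite_fsetP[X BX]; exists (finmap.enum_fset X); split; first exact: finmap.fset_uniq.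
  by [].
by rewrite -BX.
Qed.

(** A maximal [p]-independent subset of the socle [T] spans it: if [x *~ k] is in the span with [k]
    prime to [p], a Bezout relation recovers [x]. *)
Lemma ex_p_basis p S : prime p -> subgroup S -> exists B, p_basis p S B.
Proof.
move=> pp sS; pose T := S `&` [set x | x *+ p = 0].
have sT : subgroup T.
  apply: subgroupI => //; split; rewrite /= ?mul0rn // => x y /= xp yp.
  by rewrite mulrnBl xp yp subrr.
have [B [BT iB maxB]] := ex_max_indep p T.
exists B; split => //; apply/seteqP; split; first exact: span_min.
move=> x Tx; apply: contrapT => xB; apply: (xB); apply: sub_span.
rewrite -(maxB (x |` B)); [by left|by move=> y; right|by move=> y [->//|/BT]|].
apply: indepU1 => // k xk; have [px|px] := boolP (p %| k)%Z.
  split => //; case/dvdzP: px => l ->; rewrite mulrC mulrzA -pmulrn.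
  by case: Tx => _ /= ->; rewrite mul0rz.
case: xB; have : coprimez k p.
  by rewrite coprimezE coprime_sym /= prime_coprime.
case/coprimezP => -[u v] /= uv.
have -> : x = x *~ k *~ u.
  rewrite -mulrzA -[LHS]mulr1z -uv mulrzDr [k * u]mulrC.
  rewrite [v * p]mulrC [X in _ + X]mulrzA -pmulrn.
  by case: Tx => _ /= ->; rewrite mul0rz addr0.
exact: (subgroupMz (subgroup_span _)).
Qed.

Lemma free_rank_max S : maximal_independent S (free_rank S).
Proof. apply: xgetPex; exact: ex_max_indep. Qed.

Lemma p_rank_basis p S : prime p -> subgroup S -> p_basis p S (p_rank p S).
Proof. by move=> pp sS; apply: xgetPex; exact: ex_p_basis. Qed.

Lemma finite_span_torsion s : (forall x, x \in s -> torsion_mod [set 0] x) ->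
  finite_set (span [set` s]).
Proof.
elim: s => [|x s IHs] tS.
  apply: (@sub_finite_set _ _ [set 0]); last exact: finite_set1.
  by apply: span_min; [exact: subgroup_set0|].
have [k k0 /= xk] := tS x (mem_head _ _).
apply: (@sub_finite_set _ _ ((fun u => u.1 + u.2) @`
    ([set x *+ i | i in `I_k] `*` span [set` s]))); last first.
  apply: finite_image; apply: finite_setX; first exact/finite_image/finite_II.
  by apply: IHs => y ys; apply: tS; rewrite inE ys orbT.
have sA : subgroup (setadd (span [set x]) (span [set` s])).
  by apply: subgroup_setadd; exact: subgroup_span.
apply: (@subset_trans _ (setadd (span [set x]) (span [set` s]))).
  apply: span_min => // y; rewrite /= inE => /predU1P[->|ys].
    apply: setadd_subl; first exact: (subgroup0 (subgroup_span _)).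
    exact: sub_span.
  apply: setadd_subr; first exact: (subgroup0 (subgroup_span _)).
  exact: sub_span.
move=> _ [_ [z [/span1P[l ->] sz ->]]]; exists (x *+ `|(l %% k)%Z|%N, z) => //=.
  split => //=; exists `|(l %% k)%Z|%N => //=.
  have : (0 <= (l %% k)%Z < k%:Z)%R by rewrite modz_ge0 ?ltz_pmod //; lia.
  lia.
congr (_ + _); rewrite pmulrn gez0_abs ?modz_ge0 //; last by lia.
rewrite [in RHS](divz_eq l k) [RHS]mulrzDr [(l %/ k)%Z * _]mulrC mulrzA -pmulrn xk mul0rz add0r //.
Qed.

Definition ntorsion S n : set G := S `&` [set x | x *+ n = 0].

(** Strong induction: for a prime divisor [p] of [n], multiplication by [p] maps the elements killed
    by [n] to those killed by [n %/ p], and its fibres lie in translates of the finite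
    [ntorsion S p]. *)
Lemma finite_ntorsion S n : subgroup S ->
  (forall p, prime p -> finite_set (ntorsion S p)) -> (0 < n)%N ->
  finite_set (ntorsion S n).
Proof.
move=> sS fp; elim/ltn_ind: n => n IHn n0.
have [n1|n1] := leqP n 1.
  have -> : n = 1%N by lia.
  apply: (@sub_finite_set _ _ [set 0]); last exact: finite_set1.
  by move=> x [].
have pp := pdiv_prime n1; set p := pdiv n in pp.
have pn : (p %| n)%N := pdiv_dvd n.
have nE : n = (p * (n %/ p))%N by rewrite mulnC divnK.
apply: (@finite_fibers _ _ _ (ntorsion S (n %/ p)) (fun x => x *+ p)).
- apply: IHn; first by rewrite ltn_Pdiv // prime_gt1.
  by rewrite divn_gt0 ?prime_gt0 // dvdn_leq.
- move=> _ [x [Sx /= xn] <-]; split; first exact: subgroupMn.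
  by rewrite /= -mulrnA -nE.
- move=> y _; have [[x0 [[Sx0 _] x0y]]|no] := pselect (exists x, (ntorsion S n `&` (fun x => x *+ p) @^-1` [set y]) x).
    apply: (@sub_finite_set _ _ ((fun z => x0 + z) @` ntorsion S p)); last first.
      exact/finite_image/fp.
    move=> x [[Sx _] xy]; exists (x - x0); last by rewrite addrC subrK.
    by split; [exact: subgroupB|rewrite /= mulrnBl xy x0y subrr].
  by apply: (@sub_finite_set _ _ set0) => // x ?; apply: no; exists x.
Qed.

Lemma countable_span A : countable A -> countable (span A).
Proof.
move=> /countable_injP[f finj].
pose g n := xget 0 [set x | A x /\ f x = n].
pose phi (u : seq (nat * int)) := \sum_(y <- u) g y.1 *~ y.2.
apply: (@sub_countable _ _ _ (phi @` setT)); last first.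
  exact/countable_image/countableP.
apply: subset_card_le => x; rewrite -[A]image_id => /spanP[s [c [_ sA ->]]].
exists [seq (f y, c y) | y <- s] => //; rewrite /phi big_map /lincomb.
apply: eq_big_seq => y /sA Ay /=; congr (_ *~ _); rewrite /g.
have [Ax fx] := @xgetI _ 0 [set x | A x /\ f x = f y] y (conj Ay erefl).
by apply: finj fx; rewrite inE.
Qed.

Lemma countable_setadd A B : countable A -> countable B -> countable (setadd A B).
Proof.
move=> cA cB; apply: (@sub_countable _ _ _ ((fun u => u.1 + u.2) @` (A `*` B))).
  by apply: subset_card_le => _ [x [y [Ax By ->]]]; exists (x, y).
exact/countable_image/countableX.
Qed.

(** An element [x] is determined, up to an element killed by [k], by a pair of [k] and [x *+ k] with
    the latter in [B]. *)
Lemma countable_torsion_mod S B : subgroup S -> countable B ->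
  (forall n, (0 < n)%N -> countable (ntorsion S n)) ->
  (forall x, S x -> torsion_mod B x) -> countable S.
Proof.
move=> sS cB fS SB.
apply: (@sub_countable _ _ _ (\bigcup_(u in setT `*` B) (S `&` [set x | x *+ u.1.+1 = u.2]))).
  apply: subset_card_le => x Sx; have [k k0 Bx] := SB x Sx.
  by exists (k.-1, x *+ k); [|split => //=; rewrite prednK].
apply: bigcup_countable; first exact: countableX.
move=> [k y] _ /=.
have [[x0 [Sx0 x0y]]|no] := pselect (exists x, (S `&` [set x | x *+ k.+1 = y]) x).
  apply: (@sub_countable _ _ _ ((fun z => x0 + z) @` ntorsion S k.+1)); last first.
    by apply: countable_image; exact: fS.
  apply: subset_card_le => x [Sx xy]; exists (x - x0); last by rewrite addrC subrK.
  by split; [exact: subgroupB|rewrite /= mulrnBl xy x0y subrr].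
have -> : S `&` [set x | x *+ k.+1 = y] = set0 by apply/seteqP; split => // x ?; apply: no; exists x.
exact: countable0.
Qed.

End Ranks.

Lemma finite_card_max T U (A : set T) (B : set U) :
  finite_set (card_max A B) -> finite_set A /\ finite_set B.
Proof.
rewrite /card_max; case: ifPn => [AB fB|AB fA].
  have {}fB : finite_set B.
    have E : @inr T U @` B #= B by apply: inj_card_eq => x y _ _ [].
    by rewrite -(eq_finite_set E).
  by split => //; exact: card_le_finite fB.
have {}fA : finite_set A.
  have E : @inl T U @` A #= A by apply: inj_card_eq => x y _ _ [].
    by rewrite -(eq_finite_set E).
split => //; apply: contrapT => /infiniteP; move: AB => /negP AB natB; apply: AB.
by apply: card_le_trans natB; exact: finite_set_countable.
Qed.

(** * Groups whose quotients have finite socles *)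

Section QuotientMap.
Variables (G : zmodType) (N : zmodClosed G).

Definition quot_map (x : G) : Quotient.quot N := \pi_(Quotient.quot N)%qT x.

Lemma quot_map_is_zmod_morphism : zmod_morphism quot_map.
Proof.
by move=> x y; rewrite /quot_map (@Quotient.pi_add G N) (@Quotient.pi_opp G N).
Qed.

HB.instance Definition _ :=
  GRing.isZmodMorphism.Build G (Quotient.quot N) quot_map quot_map_is_zmod_morphism.

Lemma quot_map_eq0 x : quot_map x = 0 <-> x \in N.
Proof.
have -> : (x \in N) = (quot_map x == quot_map 0).
  by have := Quotient.idealrBE N x 0; rewrite subr0.
by rewrite raddf0; split=> /eqP.
Qed.

Lemma quot_map_surj (q : Quotient.quot N) : exists x, quot_map x = q.
Proof. by exists (repr q); exact: reprK. Qed.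

End QuotientMap.

(** The proof [sA] is an argument so that the [zmodClosed] structure can be inferred from the
    predicate. *)
Definition subgroup_mem (G : zmodType) (A : set G) (sA : subgroup A) : {pred G} := mem A.

Section SubgroupMem.
Variables (G : zmodType) (A : set G) (sA : subgroup A).

Lemma subgroup_mem_zmod_closed : zmod_closed (subgroup_mem sA).
Proof. by have /subgroup_zmod_closed := sA. Qed.

HB.instance Definition _ :=
  GRing.isZmodClosed.Build G (subgroup_mem sA) subgroup_mem_zmod_closed.

Lemma subgroup_memE x : x \in subgroup_mem sA <-> A x.
Proof. by rewrite /subgroup_mem inE. Qed.

End SubgroupMem.

Section FiniteSocles.

Lemma subgroup_absz (G : zmodType) (A : set G) x (k : int) : subgroup A ->
  A (x *~ k) -> A (x *+ `|k|).
Proof. by move=> sA; case: k => // n /(subgroupN sA); rewrite opprK. Qed.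

Lemma subgroup_coprime (G : zmodType) (A : set G) x m n : subgroup A ->
  coprime m n -> A (x *+ m) -> A (x *+ n) -> A x.
Proof.
move=> sA; rewrite -[coprime m n]/(coprimez m n) => /coprimezP[[u v] /= uv] Am An.
rewrite -[x]mulr1z -uv mulrzDr [u * m]mulrC [v * n]mulrC ![x *~ (_ * _)]mulrzA.
by apply: (subgroupD sA); apply: (subgroupMz sA).
Qed.

Lemma primes_coprime p q : prime p -> prime q -> p != q -> coprime p q.
Proof. by move=> pp pq; rewrite prime_coprime // dvdn_prime2. Qed.

(* In every quotient of [G], the image of [S] has only finitely many elements *)
(* of prime order. *)
Definition finite_socles (G : zmodType) (S : set G) : Prop :=
  forall L, subgroup L -> exists s : seq G,
    forall x p, S x -> prime p -> L (x *+ p) -> exists2 y, y \in s & L (x - y).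

Variables G G' : zmodType.
Implicit Types S L : set G.

Lemma finite_socles_sub (H : zmodType) (S T : set H) :
  T `<=` S -> finite_socles S -> finite_socles T.
Proof. by move=> TS fS L /fS[s sP]; exists s => x p /TS; exact: sP. Qed.

(** Either the image of [x] is in that of [M], and a translate of [x] by [M] lies in the kernel; or
    its class is one of finitely many nonzero ones, and subtracting a representative of that class
    leads back to the first case. *)
Lemma finite_socles_ext (f : {additive G -> G'}) S : subgroup S ->
  finite_socles (f @` S) -> finite_socles (S `&` f @^-1` [set 0]) ->
  finite_socles S.
Proof.
move=> sS fS kS L sL; pose M := L `&` S.
have sM : subgroup M by exact: subgroupI.
have [s1 s1P] := fS _ (subgroup_image f sM).
have [s2 s2P] := kS _ sM.
have sfM := subgroup_image f sM.
(* The prime attached to a representative is left open, so that [rep] depends on [y] only. *)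
pose rep y := xget 0 [set x | [/\ S x, exists2 p, prime p & M (x *+ p),
  (f @` M) (f x - y) & ~ (f @` M) (f x)]].
exists (s2 ++ [seq rep y + z | y <- s1, z <- s2]) => x p Sx pp Lx.
have Mx : M (x *+ p) by split => //; exact: subgroupMn.
have [[l Ml fl]|nfx] := pselect ((f @` M) (f x)).
  have [| |y ys [Ly _]] := s2P (x - l) p _ pp.
  - by split; [apply: (subgroupB sS) => //; case: Ml|rewrite /= raddfB fl subrr].
  - by rewrite mulrnBl; apply: (subgroupB sM) => //; exact: subgroupMn.
  exists y; first by rewrite mem_cat ys.
  by move: Ml => [Ll _]; have := subgroupD sL Ly Ll; rewrite addrAC subrK.
have [| |y ys fy] := s1P (f x) p _ pp; [by exists x|by exists (x *+ p) => //; rewrite raddfMn|].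
have [Srx [q pq Mrx] fry nfr] : [set x | [/\ S x, exists2 p, prime p & M (x *+ p),
  (f @` M) (f x - y) & ~ (f @` M) (f x)]] (rep y).
  by apply: xgetPex; exists x; split => //; exists p.
have [l Ml fl] : (f @` M) (f (x - rep y)).
  by have := subgroupB sfM fy fry; rewrite opprB addrA subrK raddfB.
(* A nonzero class cannot be killed by two distinct primes. *)
have qp : q = p.
  apply/eqP/negPn/negP => qp; apply: nfx; apply: (subgroup_coprime sfM (primes_coprime pq pp qp)).
    rewrite -[x](subrK (rep y)) raddfD -fl -raddfD -raddfMn mulrnDl.
    by exists (l *+ q + rep y *+ q) => //; apply: (subgroupD sM) => //; exact: subgroupMn.
  by rewrite -raddfMn; exists (x *+ p).
rewrite {q}qp in pq Mrx.
have [| |z zs [Lz _]] := s2P (x - rep y - l) p _ pp.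
- split; last by rewrite /= raddfB fl subrr.
  by apply: (subgroupB sS); [exact: subgroupB|case: Ml].
- rewrite !mulrnBl; apply: (subgroupB sM); last exact: subgroupMn.
  exact: subgroupB.
exists (rep y + z); first by rewrite mem_cat; apply/orP; right; exact: allpairs_f.
case: Ml => Ll _; have := subgroupD sL Lz Ll.
by rewrite addrAC subrK opprD addrA.
Qed.

Lemma finite_socles_set0 (H : zmodType) : finite_socles [set (0 : H)].
Proof.
move=> L sL; exists [:: 0] => x p -> _ _; exists 0; rewrite ?mem_head // subr0.
exact: subgroup0.
Qed.

Lemma finite_socles_inj (f : {additive G -> G'}) S : subgroup S ->
  (forall x, S x -> f x = 0 -> x = 0) ->
  finite_socles (f @` S) -> finite_socles S.
Proof.
move=> sS finj fS; apply: (finite_socles_ext sS fS).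
apply: finite_socles_sub _ (@finite_socles_set0 G) => x [Sx /= fx].
exact: finj.
Qed.

Lemma finite_socles_image (f : {additive G -> G'}) S :
  finite_socles S -> finite_socles (f @` S).
Proof.
move=> fS L sL; have [s sP] := fS _ (subgroup_preimage f sL).
exists (map f s) => _ p [x Sx <-] pp; rewrite -raddfMn => Lx.
have [y ys Ly] := sP x p Sx pp Lx.
by exists (f y); rewrite ?map_f // -raddfB.
Qed.

(** Modulo [L] the cyclic group is either finite or infinite cyclic, and the latter has no element
    of prime order. *)
Lemma finite_socles_cycle (H : zmodType) (x : H) : finite_socles (span [set x]).
Proof.
move=> L sL; have [[k k0 Lk]|tf] := pselect (torsion_mod L x).
  exists [seq x *+ i | i <- iota 0 k] => _ p /span1P[l ->] _ _.
  have lk : (0 <= (l %% k)%Z < k%:Z)%R by rewrite modz_ge0 ?ltz_pmod //; lia.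
  exists (x *+ `|(l %% k)%Z|%N); first by rewrite map_f // mem_iota; lia.
  rewrite pmulrn gez0_abs; last by case/andP: lk.
  rewrite {1}(divz_eq l k) [X in L (X - _)]mulrzDr addrK mulrC mulrzA -pmulrn.
  exact: subgroupMz.
exists [:: 0] => _ p /span1P[l ->] pp Lp; exists 0; rewrite ?mem_head // subr0.
have [->|l0] := eqVneq l 0; first by rewrite mulr0z; exact: subgroup0.
case: tf; exists (`|l| * p)%N; first by rewrite muln_gt0 absz_gt0 l0 prime_gt0.
have -> : (`|l| * p)%N = `|(l * p%:Z)%R|%N by rewrite abszM.
by apply: (subgroup_absz sL); rewrite mulrzA -pmulrn.
Qed.

Lemma exists_distinct_mod (X L : set G) n :
  ~ (exists s : seq G, forall x, X x -> exists2 y, y \in s & L (x - y)) ->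
  exists s : seq G, [/\ size s = n, forall x, x \in s -> X x &
    forall i j, (i < j < n)%N -> ~ L (s`_j - s`_i)].
Proof.
move=> noS; elim: n => [|n [s [sn sX sL]]]; first by exists [::]; split => // i j; lia.
have [x [Xx xs]] : exists x, X x /\ forall y, y \in s -> ~ L (x - y).
  apply: contrapT => nox; apply: noS; exists s => x Xx; apply: contrapT => nxs.
  by apply: nox; exists x; split => // y ys Lxy; apply: nxs; exists y.
exists (rcons s x); split; first by rewrite size_rcons sn.
  by move=> y; rewrite mem_rcons inE => /predU1P[->//|/sX].
move=> i j; rewrite !nth_rcons sn => /andP[ij]; rewrite ltnS leq_eqVlt => /predU1P[jn|jn].
  by rewrite -jn ltnn eqxx ij; apply: xs; apply: mem_nth; rewrite sn -jn.
by rewrite jn (ltn_trans ij jn); apply: sL; rewrite ij.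
Qed.

(* [(x_i, l) |-> x_i + l] maps [n.+1] cosets of [L] injectively into *)
(* [{x in F | x *+ p in L}], which multiplication by [p] maps to [L] with *)
(* fibres of size at most [n = |S[p]|]. *)
Lemma finite_socle_prime S L p : subgroup S ->
  (forall x, S x -> torsion_mod [set 0] x) -> finite_set (ntorsion S p) ->
  subgroup L -> L `<=` S ->
  exists s : seq G, forall x, (S `&` [set x | L (x *+ p)]) x ->
    exists2 y, y \in s & L (x - y).
Proof.
move=> sS tS /finite_seqP[t0 tE] sL LS; apply: contrapT.
pose t := undup t0; pose n := size t.
have tP x : ntorsion S p x <-> x \in t by rewrite tE /= mem_undup.
move=> /(@exists_distinct_mod _ _ n.+1)[xs [xsn xsX xsL]].
(* Inside the finite group [F] the counting involves finite sets only. *)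
pose F := span [set` xs].
have sF : subgroup F := subgroup_span _.
have FS : F `<=` S by apply: span_min => // x /= /xsX[].
have fF : finite_set F.
  by apply: finite_span_torsion => x /xsX[/tS].
have /finite_seqP[l0 lE] : finite_set (L `&` F) by exact: finite_setIr.
pose l := undup l0.
have lP x : (L `&` F) x <-> x \in l by rewrite lE /= mem_undup.
pose r y := xget 0 [set x | S x /\ x *+ p = y].
(* As [r] chooses a [p]-th part in [S], the second component is killed by [p] for [x] in [F], and
   takes at most [n] values. *)
pose g x := (x *+ p, x - r (x *+ p)).
have g_inj x y : g x = g y -> x = y by case=> -> /addIr.
have [I [uI sI IP]] : exists I : seq nat,
    [/\ uniq I, size I = n.+1 & forall i, i \in I -> (i < n.+1)%N].
  exists (iota 0 n.+1); split; rewrite ?iota_uniq ?size_iota // => i.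
  by rewrite mem_iota.
pose U := [seq g (xs`_i + z) | i <- I, z <- l].
have uU : uniq U.
  apply: allpairs_uniq; rewrite ?undup_uniq // => -[i z] [j z'].
  move=> /allpairsP[[i1 z1] [i1n z1l E1]] /allpairsP[[j1 z2] [j1n z2l E2]].
  rewrite /= in i1n z1l E1 j1n z2l E2 *.
  case: E1 E2 => -> -> [-> ->] {i j z z'} /g_inj E.
  have Lij : forall i j z z', z \in l -> z' \in l -> (i < j < n.+1)%N -> xs`_i + z = xs`_j + z' -> False.
    move=> i j z z' /lP[Lz _] /lP[Lz' _] /xsL nL E'; apply: nL.
    have -> : xs`_j - xs`_i = z - z'.
      by apply/eqP; rewrite subr_eq addrAC eq_sym subr_eq addrC E'.
    exact: subgroupB.
  move: i1n j1n => /IP i1n /IP j1n.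
  case: (ltngtP i1 j1) => [ij|ji|ij].
  - by case: (Lij i1 j1 z1 z2) => //; lia.
  - by case: (Lij j1 i1 z2 z1) => //; lia.
  - by move: E; rewrite ij => /addrI ->.
have : {subset U <= [seq (y, z) | y <- l, z <- t]}.
  move=> _ /allpairsP[[i z] /= [/IP iN /lP[Lz Fz] ->]].
  have xi : xs`_i \in xs by apply: mem_nth; rewrite xsn; lia.
  have [Sx /= Lx] := xsX _ xi; set x := xs`_i + z.
  have Fx : F x by apply: (subgroupD sF) => //; exact: sub_span.
  have xp : (L `&` F) (x *+ p).
    split; last exact: (subgroupMn sF).
    by rewrite mulrnDl; apply: (subgroupD sL) => //; exact: (subgroupMn sL).
  apply: allpairs_f; first exact/lP.
  have [Sr /= rE] : [set y | S y /\ y *+ p = x *+ p] (r (x *+ p)).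
    by apply: (@xgetI _ _ _ x); split => //; exact: FS.
  apply/tP; split; first by apply: (subgroupB sS) => //; exact: FS.
  by rewrite /= mulrnBl rE subrr.
(* The inequality between [n.+1] times and [n] times [size l] forces [l] to be empty, although it
   contains [0]. *)
move=> /(uniq_leq_size uU); rewrite !size_allpairs sI -/n.
rewrite mulnC mulnS -[X in (_ <= X)%N]add0n leq_add2r leqn0 => /nilP l_nil.
have /lP : (L `&` F) 0 by split; [exact: subgroup0 sL|exact: subgroup0 sF].
by rewrite l_nil.
Qed.

(** The primes in [ps] are handled by [finite_socle_prime]. For any other prime [p], the order of
    [x] is prime to [p], so [x] is already in [L]. *)
Lemma finite_socles_torsion S (ps : seq nat) : subgroup S ->
  (forall x, S x -> torsion_mod [set 0] x) ->
  (forall p, prime p -> finite_set (ntorsion S p)) ->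
  (forall p x, prime p -> p \notin ps -> S x -> x *+ p = 0 -> x = 0) ->
  finite_socles S.
Proof.
move=> sS tS fS ps0 L sL; pose M := L `&` S.
have sM : subgroup M by exact: subgroupI.
have ex_sp p : exists s : seq G, prime p -> forall x, S x -> M (x *+ p) ->
    exists2 y, y \in s & M (x - y).
  have [pp|npp] := boolP (prime p); last by exists [::].
  have [|s sP] := finite_socle_prime sS tS (fS p pp) sM; first by move=> x [].
  by exists s => _ x Sx Mx; apply: sP; split.
have [sp spP] := choice ex_sp.
exists (0 :: flatten [seq sp p | p <- ps]) => x p Sx pp Lx.
have Mx : M (x *+ p) by split => //; exact: subgroupMn.
have [pps|pps] := boolP (p \in ps).
  have [y ys [Ly _]] := spP p pp x Sx Mx.
  exists y => //; rewrite inE; apply/orP; right; apply/flattenP; exists (sp p) => //.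
  exact: map_f.
exists 0; rewrite ?mem_head // subr0.
have exN : exists N, (0 < N)%N && (x *+ N == 0).
  by have [k k0 /= xk] := tS x Sx; exists k; rewrite k0 xk eqxx.
case: (ex_minnP exN) => N /andP[N0 /eqP xN] minN.
apply: (@subgroup_coprime _ L x p N sL) => //; last by rewrite xN; exact: subgroup0.
rewrite prime_coprime //; apply/negP => pN.
have : (N %/ p < N)%N by rewrite ltn_Pdiv // prime_gt1.
rewrite ltnNge => /negP; apply; apply: minN.
rewrite divn_gt0 ?prime_gt0 // dvdn_leq //=; apply/eqP.
apply: (ps0 p _ pp pps); first exact: subgroupMn.
by rewrite -mulrnA divnK.
Qed.

End FiniteSocles.

Lemma finite_socles_span (G : zmodType) (s : seq G) : finite_socles (span [set` s]).
Proof.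
elim: s => [|x s IHs].
  apply: finite_socles_sub _ (@finite_socles_set0 G).
  by apply: span_min; [exact: subgroup_set0|].
pose N := subgroup_mem (subgroup_span [set` s]).
apply: (@finite_socles_ext _ _ (quot_map N)); first exact: subgroup_span.
  apply: finite_socles_sub _ (finite_socles_cycle (quot_map N x)) => _ [y sy <-].
  move: y sy; rewrite -[forall y, _]/(_ `<=` quot_map N @^-1` span [set quot_map N x]).
  apply: span_min; first exact: subgroup_preimage (subgroup_span _).
  move=> y /=; rewrite inE /preimage /= => /predU1P[->|ys]; first exact: sub_span.
  have /quot_map_eq0 -> : y \in N by apply/subgroup_memE; exact: sub_span.
  exact: (subgroup0 (subgroup_span _)).
by apply: finite_socles_sub _ IHs => y [_ /quot_map_eq0 /subgroup_memE].
Qed.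

Lemma finite_sum_p_rank (G : zmodType) (S : set G) : subgroup S ->
  finite_set (sum_p_rank S) ->
  (forall p, prime p -> finite_set (ntorsion S p)) /\
  exists ps : seq nat, forall p x, prime p -> p \notin ps -> S x -> x *+ p = 0 -> x = 0.
Proof.
move=> sS fS.
split=> [p pp|].
  have [_ pE] := p_rank_basis pp sS.
  have /finite_seqP[s sE] : finite_set (p_rank p S).
    apply: (@sub_finite_set _ _ (snd @` sum_p_rank S)); last exact: finite_image.
    by move=> x Bx; exists (p, x).
  rewrite /ntorsion -pE sE; apply: finite_span_torsion => x xs.
  have : span (p_rank p S) x by apply: sub_span; rewrite sE.
  by rewrite pE => -[_ /= x0]; exists p => //; exact: prime_gt0.
have /finite_seqP[ps psE] : finite_set (fst @` sum_p_rank S) by exact: finite_image.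
exists ps => p x pp pps Sx xp; have [_ pE] := p_rank_basis pp sS.
have : span (p_rank p S) x by rewrite pE; split.
suff -> : p_rank p S = set0.
  by move: x {Sx xp}; apply: span_min; [exact: subgroup_set0|].
apply/seteqP; split => // y py; move/negP: pps; apply.
have : (fst @` sum_p_rank S) p by exists (p, y).
by rewrite psE.
Qed.

(** * Finitely generated subgroups with torsion quotient *)

Section Lattice.
Variables (H : zmodType) (A : zmodClosed H) (b : seq H).
Hypothesis Ab : [set` A] = span [set` b].
Hypothesis tA : is_torsion (Quotient.quot A).

Lemma torsion_quot_set0 (x : Quotient.quot A) : torsion_mod [set 0] x.
Proof. by have /asboolP[k k0 xk] := tA x; exists k. Qed.

(** From left to right, both [A] and the torsion quotient have finite socles, hence so does their
    extension [H]. Conversely, the case [L = A] bounds the elements of prime order in the quotient.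
    The right-hand side does not mention [A], so any two choices of [A] can be compared. *)
Lemma finite_socles_lattice :
  finite_set (sum_p_rank [set: Quotient.quot A]) <-> finite_socles [set: H].
Proof.
split=> [/finite_sum_p_rank[//|fp [ps psP]]|fH].
  apply: (@finite_socles_ext _ _ (quot_map A)) => //.
    apply: (@finite_socles_sub _ setT) => //.
    apply: (@finite_socles_torsion _ _ ps) => // x _; exact: torsion_quot_set0.
  apply: finite_socles_sub _ (finite_socles_span b) => x [_ /= /quot_map_eq0].
  by rewrite -Ab.
have [s sP] := fH _ (subgroup_zmodClosed A).
apply: (@finite_fibers _ _ _ [set` map (quot_map A) s] snd) => //.
  move=> _ [[p x] /= [pp px] <-]; have [y yx] := quot_map_surj x.
  have [_ pE] := p_rank_basis pp (subgroup_setT (Quotient.quot A)).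
  have : span (p_rank p [set: Quotient.quot A]) x by exact: sub_span.
  rewrite pE => -[_ /= xp]; have [|z zs Az] := sP y p I pp.
    by apply/quot_map_eq0; rewrite raddfMn /= yx.
  apply/mapP; exists z => //; rewrite -yx; apply/eqP; rewrite -subr_eq0 -raddfB.
  by apply/eqP/quot_map_eq0.
(* A member of a [p]-basis is nonzero and so determines [p]: the fibres of [snd] have at most one
   element. *)
move=> x _; have pU p q : p <> q -> sum_p_rank [set: Quotient.quot A] (p, x) ->
    sum_p_rank [set: Quotient.quot A] (q, x) -> False.
  move=> pq [/= pp px] [/= pq' qx].
  have [ip pE] := p_rank_basis pp (subgroup_setT (Quotient.quot A)).
  have [_ qE] := p_rank_basis pq' (subgroup_setT (Quotient.quot A)).
  have : span (p_rank p [set: Quotient.quot A]) x by exact: sub_span.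
  have : span (p_rank q [set: Quotient.quot A]) x by exact: sub_span.
  rewrite pE qE => -[_ /= xq] [_ /= xp].
  have x0 : x = 0.
    apply: (@subgroup_coprime _ [set 0] x p q) => //; first exact: subgroup_set0.
    by apply: primes_coprime => //; exact/eqP.
  have : {in [:: x], forall y, (p %| 1)%Z}.
    apply: (ip [:: x] (fun=> 1)) => //; last by rewrite big_seq1 x0 mul0rz.
    by move=> y /=; rewrite inE => /eqP ->.
  move=> /(_ x (mem_head _ _)); rewrite dvdzE /= dvdn1 => /eqP p1.
  by rewrite p1 in pp.
have [[p px]|no] := pselect (exists p, sum_p_rank [set: Quotient.quot A] (p, x)).
  apply: (@sub_finite_set _ _ [set (p, x)]); last exact: finite_set1.
  move=> [q y] [qy /= yx]; rewrite yx in qy *.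
  by have [->//|/eqP qp] := eqVneq q p; case: (pU _ _ qp qy px).
apply: (@sub_finite_set _ _ set0) => // -[q y] [qy /= yx]; apply: no.
by exists q; rewrite -yx.
Qed.

End Lattice.

(** * Necessity: SSGP groups of finite rank with finite socles are indiscrete *)

Section TopologicalGroup.
Variable G : topologicalZmodType.
Implicit Types (A U V : set G) (x y : G).

(** Separation is not assumed of the continuous images considered below; for a Hausdorff group this
    means triviality. *)
Definition indiscrete : Prop := forall U, nbhs (0 : G) U -> forall x, U x.

Lemma nbhs0_subr U : nbhs (0 : G) U ->
  exists2 V, nbhs (0 : G) V & forall x y, V x -> V y -> U (x - y).
Proof.
move=> U0; have : nbhs ((0 : G) - 0) U by rewrite subr0.
move=> /(@sub_continuous G (0, 0))[[V W] /= [V0 W0] VW].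
exists (V `&` W); first exact: filterI.
by move=> x y [Vx _] [_ Wy]; exact: (VW (x, y)).
Qed.

Lemma nbhs0_addr U : nbhs (0 : G) U ->
  exists2 V, nbhs (0 : G) V & forall x y, V x -> V y -> U (x + y).
Proof.
move=> U0; have : nbhs ((0 : G) + 0) U by rewrite addr0.
move=> /(@add_continuous G (0, 0))[[V W] /= [V0 W0] VW].
exists (V `&` W); first exact: filterI.
by move=> x y [Vx _] [_ Wy]; exact: (VW (x, y)).
Qed.

Lemma continuous_addr x : continuous (fun y : G => y + x).
Proof.
move=> y; apply: (@continuous_comp _ _ _ (fun z => (z, x)) (fun z : G * G => z.1 + z.2)).
  by apply: cvg_pair; [exact: cvg_id|exact: cvg_cst].
exact: add_continuous.
Qed.

Lemma nbhs_shift x y U : nbhs x U -> nbhs y [set z | U (z + (x - y))].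
Proof.
by move=> Ux; apply: (@continuous_addr (x - y) y U); rewrite addrC subrK.
Qed.

Lemma closure_nbhs0 A x : closure A x <->
  forall U, nbhs (0 : G) U -> exists2 a, A a & U (a - x).
Proof.
split=> [Ax U U0|Ax B Bx].
  have [a [Aa]] := Ax _ (nbhs_shift x U0).
  by rewrite /= sub0r => Ua; exists a.
have [a Aa] := Ax _ (nbhs_shift 0 Bx).
by rewrite /= subr0 subrK => Ba; exists a.
Qed.

Lemma subgroup_closure A : subgroup A -> subgroup (closure A).
Proof.
move=> sA; split; first by apply: subset_closure; exact: subgroup0.
move=> x y /closure_nbhs0 Ax /closure_nbhs0 Ay; apply/closure_nbhs0 => U.
move=> /nbhs0_subr[V V0 VU]; have [a Aa ax] := Ax V V0; have [b Ab bY] := Ay V V0.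
exists (a - b); first exact: subgroupB.
by have := VU _ _ ax bY; congr (U _); rewrite !opprD opprK addrACA.
Qed.

Lemma closureK A : closure (closure A) = closure A.
Proof. by apply/esym/closure_id; exact: closed_closure. Qed.

Lemma closure_sub_nbhs0 U : nbhs (0 : G) U ->
  exists2 V, nbhs (0 : G) V & closure V `<=` U.
Proof.
move=> /nbhs0_subr[V V0 VU]; exists V => // x /closure_nbhs0 /(_ V V0)[a Va ax].
by have := VU _ _ Va ax; rewrite opprB addrC subrK.
Qed.

Lemma nbhs0_seq (s : seq G) (W : G -> set G) :
  (forall y, y \in s -> nbhs (0 : G) (W y)) ->
  nbhs (0 : G) [set x | forall y, y \in s -> W y x].
Proof.
elim: s => [|y s IHs] Ws; first by apply: filterS (@filterT _ _ _) => x _ y.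
apply: filterS (filterI (Ws y (mem_head _ _)) (IHs _)) => [x [Wx Wsx] z|z zs].
  by rewrite inE => /predU1P[->|/Wsx].
by apply: Ws; rewrite inE zs orbT.
Qed.

Lemma continuous_mulrn n : continuous (fun x : G => x *+ n).
Proof.
move=> x; elim: n => [|n IHn]; first by under eq_fun do rewrite mulr0n; exact: cvg_cst.
have -> : (fun y : G => y *+ n.+1) = (fun y => y + y *+ n).
  by apply/funext => y; rewrite mulrS.
apply: (@continuous_comp _ _ _ (fun y => (y, y *+ n)) (fun z : G * G => z.1 + z.2)).
  by apply: cvg_pair; [exact: cvg_id|exact: IHn].
exact: add_continuous.
Qed.

(* The closure [C] of a finitely generated subgroup inside a small [V], of *)
(* maximal rank for that property, contains [Cyc W] for small [W]: an element *)
(* of [Cyc W] is torsion modulo [C], and [W] avoids the finite socle of [G/C]. *)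
Lemma SSGP_indiscrete (b : seq G) :
  (forall x, torsion_mod (span [set` b]) x) -> finite_socles [set: G] ->
  (forall U, nbhs (0 : G) U -> forall x, closure (span (Cyc U)) x) ->
  indiscrete.
Proof.
move=> tb fG dU U0 nU0 x.
(* [P l] asks for free subgroups of rank [l] in all neighbourhoods of zero; the largest such [l] is
   at most [size b]. *)
pose P l := `[< forall U, nbhs (0 : G) U -> exists s : seq G,
  [/\ uniq s, size s = l, independent 0 [set` s] & span [set` s] `<=` U] >].
have exP : exists l, P l.
  exists 0%N; apply/asboolP => U nU; exists [::]; split => //.
    by move=> s c _ s0 _ y /s0.
  apply: (@subset_trans _ [set 0]); last by move=> y ->; exact: nbhs_singleton.
  by apply: span_min => //; exact: subgroup_set0.
have maxP l : P l -> (l <= size b)%N.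
  move=> /asboolP /(_ setT (@filterT _ _ _))[s [us <- si _]].
  by apply: indep_size => // y _; exact: tb.
case: (ex_maxnP exP maxP) => l /asboolP Pl lmax {exP maxP}.
have [U1 nU1 U1P] : exists2 U1, nbhs (0 : G) U1 & forall s : seq G, uniq s ->
    size s = l.+1 -> independent 0 [set` s] -> ~ (span [set` s] `<=` U1).
  apply: contrapT => no; suff /lmax : P l.+1 by rewrite ltnn.
  apply/asboolP => U nU; apply: contrapT => nos; apply: no; exists U => // s us ss si sU.
  by apply: nos; exists s.
have [U2 nU2 U2U0] := closure_sub_nbhs0 nU0.
have [V nV VU] := nbhs0_addr (filterI nU1 nU2).
have V0 : V 0 := nbhs_singleton nV.
have [s [us sl si sV]] := Pl V nV.
pose B := span [set` s]; have sB : subgroup B := subgroup_span _.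
(* Otherwise [y :: s] would generate a free subgroup of rank [l.+1] inside [V + V], hence inside
   [U1]. *)
have CycV y : Cyc V y -> torsion_mod B y.
  move=> /CycP yV; apply: contrapT => yB.
  have ys : y \notin s.
    by apply/negP => ys; apply: yB; exists 1%N => //; exact: sub_span.
  have ysE : [set` y :: s] = y |` [set` s].
    by apply/seteqP; split => z /=; rewrite inE => /predU1P.
  apply: (U1P (y :: s)); rewrite /= ?ys ?us ?sl // ysE.
    apply: indepU1 => // k yk; have [->|k0] := eqVneq k 0; first by rewrite mulr0z.
    by case: yB; exists `|k|%N; [rewrite absz_gt0|exact: (subgroup_absz sB)].
  apply: (@subset_trans _ (setadd (span [set y]) B)).
    apply: span_min; first exact: subgroup_setadd (subgroup_span _) sB.
    move=> z [->|zs].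
      by apply: setadd_subl; [exact: subgroup0 sB|exact: sub_span].
    by apply: setadd_subr; [exact: subgroup0 (subgroup_span _)|exact: sub_span].
  move=> _ [_ [z [/span1P[k ->] Bz ->]]].
  by have [] := VU _ _ (yV k) (sV _ Bz).
have BU2 : B `<=` U2.
  by move=> z Bz; have [_] := VU _ _ (sV _ Bz) V0; rewrite addr0.
pose C := closure B; have sC : subgroup C := subgroup_closure sB.
have CU0 : C `<=` U0 := subset_trans (closureS BU2) U2U0.
have [t tP] := fG C sC.
(* [t] represents the elements of prime order modulo [C]; since [C] is closed, a small [W] misses
   the coset of each [y] in [t] outside [C]. *)
pose W := V `&` [set w | forall y, y \in t -> C y \/ ~ C (w - y)].
have nW : nbhs (0 : G) W.
  apply: filterI => //; apply: nbhs0_seq => y _.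
  have [Cy|nCy] := pselect (C y); first by apply: filterS (@filterT _ _ _) => ? _; left.
  have : ~ closure C (- y).
    by rewrite /C closureK => /(subgroupN sC); rewrite opprK.
  rewrite /closure /= => /existsNP[D] /not_implyP[nD CD].
  have := nbhs_shift 0 nD; apply: filterS => w; rewrite /= subr0 => Dw.
  by right => Cw; apply: CD; exists (w - y).
have CycW : Cyc W `<=` C.
  move=> w /CycP Ww; have wV : Cyc V w by apply/CycP => k; case: (Ww k).
  have exk : exists k, (0 < k)%N && `[< C (w *+ k) >].
    have [k k0 Bk] := CycV w wV; exists k; rewrite k0; apply/asboolP.
    exact: subset_closure.
  case: (ex_minnP exk) => k /andP[k0 /asboolP Ck] mink.
  have [k1|k1] := leqP k 1.
    by move: Ck; have -> : k = 1%N by lia.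
  (* If [k > 1], the multiple of [w] by [k %/ p] has prime order modulo [C] but still lies in [W],
     so it is in [C], against the minimality of [k]. *)
  have pp := pdiv_prime k1; set p := pdiv k in pp.
  have [|y yt Cy] := tP (w *+ (k %/ p)) p I pp.
    by rewrite -mulrnA divnK // pdiv_dvd.
  have [_ /(_ y yt)[yC|//]] := Ww (k %/ p)%N.
  have : (k %/ p < k)%N by rewrite ltn_Pdiv // prime_gt1.
  rewrite ltnNge => /negP; case; apply: mink.
  rewrite divn_gt0 ?prime_gt0 // dvdn_leq ?pdiv_dvd //=; apply/asboolP.
  by have := subgroupD sC Cy yC; rewrite subrK.
apply: CU0; rewrite /C -closureK; apply: closureS (dU W nW x).
exact: span_min.
Qed.

End TopologicalGroup.

(** * Topological quotients and the induction on the ordinal *)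

Section TopologicalQuotient.
Variables (G : topologicalZmodType) (N : zmodClosed G).

Definition topquot_map (x : G) : topquot N := \pi_(topquot N)%qT x.

Lemma topquot_map_is_zmod_morphism : zmod_morphism topquot_map.
Proof.
move=> x y; rewrite /topquot_map.
by rewrite (@Quotient.pi_add G N) (@Quotient.pi_opp G N).
Qed.

HB.instance Definition _ := GRing.isZmodMorphism.Build G (topquot N) topquot_map
  topquot_map_is_zmod_morphism.

Lemma topquot_map_eq0 x : topquot_map x = 0 <-> x \in N.
Proof.
rewrite -(raddf0 topquot_map) -[in X in _ <-> X](subr0 x) (Quotient.idealrBE N x 0).
exact: (rwP (@eqP {ideal_quot N} (\pi_({ideal_quot N})%qT x) (\pi_({ideal_quot N})%qT 0))).
Qed.

Lemma topquot_map_eq x y : topquot_map x = topquot_map y <-> x - y \in N.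
Proof.
rewrite -topquot_map_eq0 raddfB /=; split=> [->|/eqP]; first exact: subrr.
by rewrite subr_eq0 => /eqP.
Qed.

Lemma topquot_mapK (q : topquot N) : topquot_map (repr q) = q.
Proof. exact: reprK. Qed.

(** The image of a neighbourhood of zero is a neighbourhood, hence the whole quotient; so [N] is
    dense as well as closed. *)
Lemma topquot_indiscrete : (forall x, closure [set` N] x -> x \in N) ->
  indiscrete (topquot N) -> forall x, x \in N.
Proof.
move=> clN iN x; apply/negPn/negP => xN.
have : ~ closure [set` N] (- x).
  by move=> /clN; rewrite rpredN; exact/negP.
rewrite /closure /= => /existsNP[D] /not_implyP[nD ND].
have := topquot_nbhs_pi N (nbhs_shift 0 nD).
rewrite -/(topquot_map 0) raddf0 => /iN /(_ (topquot_map x))[y /=].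
rewrite subr0 => Dy /topquot_map_eq yx; apply: ND; by exists (y - x).
Qed.

End TopologicalQuotient.

(* The induction principle that Rocq derives from [SSGP_ord] ignores the *)
(* occurrence nested under [exists] and [/\]. *)
Fixpoint SSGP_ord_ind_nested (P : topologicalZmodType -> Prop)
    (P0 : forall G : topologicalZmodType, (forall x : G, x = 0) -> P G)
    (PS : forall G : topologicalZmodType,
      (forall U, nbhs (0 : G) U -> P (topquot (cyc_kernel U))) -> P G)
    (alpha : ord) (G : topologicalZmodType) (h : SSGP_ord alpha G) : P G :=
  match h with
  | SSGP_ord_zero _ G0 => P0 G G0
  | SSGP_ord_pos _ IH => PS G (fun U nU =>
      match IH U nU with
      | ex_intro beta (conj _ hbeta) => SSGP_ord_ind_nested P0 PS hbeta
      end)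
  end.

(** Arbitrary continuous images [Q] are needed for the induction: when [G] is replaced by its
    quotient by [K], [Q] is replaced by its quotient by [L]. Once that quotient is indiscrete, the
    closed subgroup [L] is everything, and [SSGP_indiscrete] applies. *)
Lemma SSGP_ord_indiscrete (alpha : ord) (G : topologicalZmodType)
    (Q : topologicalZmodType) (f : {additive G -> Q}) (b : seq Q) :
  SSGP_ord alpha G -> continuous f -> (forall y, exists x, f x = y) ->
  (forall y, torsion_mod (span [set` b]) y) -> finite_socles [set: Q] ->
  indiscrete Q.
Proof.
move=> h; move: Q f b; elim/SSGP_ord_ind_nested: h => {}G.
  move=> G0 Q f b _ fsurj _ _ U /nbhs_singleton U0 y; have [x <-] := fsurj y.
  by rewrite (G0 x) raddf0.
move=> IH Q f b cf fsurj tb fQ.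
apply: (SSGP_indiscrete tb fQ) => U nU.
have nV : nbhs (0 : G) (f @^-1` U) by apply: cf; rewrite raddf0.
have {}IH := IH _ nV.
set K := cyc_kernel (f @^-1` U) in IH; pose L := cyc_kernel U.
(* Homomorphisms preserve cyclic subgroups and continuous maps send closures into closures; so [f]
   maps [K] into [L] and induces [g] between the quotients. *)
have KL x : x \in K -> f x \in L.
  rewrite !inE /= => Kx; have : closure (f @` span (Cyc (f @^-1` U))) (f x).
    move=> D /cf /Kx[y [Ky Dy]]; exists (f y); split => //; by exists y.
  apply: closureS => _ [y sy <-]; move: y sy.
  apply: (span_min (subgroup_preimage f (subgroup_span _))) => y /CycP Uy.
  by apply: sub_span; apply/CycP => k; rewrite -raddfMz; exact: Uy.
pose g (q : topquot K) : topquot L := topquot_map L (f (repr q)).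
have gE x : g (topquot_map K x) = topquot_map L (f x).
  apply/topquot_map_eq; rewrite -raddfB; apply: KL; apply/topquot_map_eq.
  exact: topquot_mapK.
have g_morph : zmod_morphism g.
  move=> q r; rewrite -(topquot_mapK q) -(topquot_mapK r) -raddfB !gE.
  by rewrite !raddfB.
pose gM := GRing.isZmodMorphism.Build _ _ g g_morph.
pose g' : {additive topquot K -> topquot L} := HB.pack g gM.
have iL : indiscrete (topquot L).
  apply: (IH _ g' (map (topquot_map L) b)).
  - apply/quotient_continuous.
    have -> : g' \o \pi_(topquot K)%qT = topquot_map L \o f.
      by apply/funext => x; exact: gE.
    move=> x; apply: continuous_comp; [exact: cf|exact: pi_continuous].
  - move=> q; have [x fx] := fsurj (repr q); exists (topquot_map K x).
    by rewrite /= gE fx topquot_mapK.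
  - move=> q; have [k k0 bk] := tb (repr q); exists k => //.
    rewrite -(topquot_mapK q) -raddfMn.
    have : forall y, span [set` b] y -> span [set` map (topquot_map L) b] (topquot_map L y).
      apply: (span_min (subgroup_preimage (topquot_map L) (subgroup_span _))).
      by move=> y yb; apply: sub_span; rewrite /= map_f.
    exact.
  - apply: finite_socles_sub _ (finite_socles_image (topquot_map L) fQ) => q _.
    by exists (repr q) => //; exact: topquot_mapK.
move=> x; have : x \in L; last by rewrite inE.
apply: (topquot_indiscrete _ iL) => {}x.
rewrite (_ : [set` L] = closure (span (Cyc U))); first by rewrite closureK inE.
by apply/seteqP; split => y; rewrite /= inE.
Qed.

Section TorsionQuotient.
Variables (G : zmodType) (n : nat).

Definition ntorsion_pred : {pred G} := fun x => x *+ n == 0.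

Lemma ntorsion_zmod_closed : zmod_closed ntorsion_pred.
Proof.
split; rewrite ?unfold_in /ntorsion_pred ?mul0rn // => x y; rewrite !unfold_in.
by move=> /eqP xn /eqP yn; rewrite mulrnBl xn yn subrr.
Qed.

HB.instance Definition _ :=
  GRing.isZmodClosed.Build G ntorsion_pred ntorsion_zmod_closed.

End TorsionQuotient.

(** Multiplication by [n] embeds the quotient by the [n]-torsion into [multiples G n], which
    transfers finite socles. Being also a continuous image of [T], this quotient is indiscrete,
    while the [n]-torsion is closed because [T] is Hausdorff. *)
Lemma SSGP_ord_multiples (G : zmodType) alpha n (b : seq G) :
  admits_SSGP_ord alpha G ->
  (forall x : G, torsion_mod (span [set` b]) x) -> finite_socles (multiples G n) ->
  forall x : G, x *+ n = 0.
Proof.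
move=> [tau h] tb fG; pose T : topologicalZmodType := topologized tau.
pose N : zmodClosed T := @ntorsion_pred T n.
pose phi (q : topquot N) : G := (repr q : T) *+ n.
have phiE x : phi (topquot_map N x) = (x : G) *+ n.
  apply/eqP; rewrite -subr_eq0 -mulrnBl; have /topquot_map_eq := topquot_mapK (topquot_map N x).
  exact.
have phi_morph : zmod_morphism phi.
  move=> q r; rewrite -(topquot_mapK q) -(topquot_mapK r) -raddfB !phiE.
  by rewrite -mulrnBl.
pose phiM := GRing.isZmodMorphism.Build _ _ phi phi_morph.
pose phi' : {additive topquot N -> G} := HB.pack phi phiM.
have fQ : finite_socles [set: topquot N].
  apply: (@finite_socles_inj _ _ phi') => // [q _ /= q0|].
    rewrite -(topquot_mapK q); apply/topquot_map_eq0; exact/eqP.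
  apply: finite_socles_sub _ fG => _ [q _ <-]; by exists (repr q).
have iQ : indiscrete (topquot N).
  apply: (@SSGP_ord_indiscrete _ _ _ (topquot_map N) (map (topquot_map N) b) h) => //.
  - exact: pi_continuous.
  - by move=> q; exists (repr q); exact: topquot_mapK.
  move=> q; have [k k0 bk] := tb (repr q : T); exists k => //.
  rewrite -(topquot_mapK q) -raddfMn.
  have : forall y, span [set` b] y -> span [set` map (topquot_map N) b] (topquot_map N y).
    apply: (@span_min T _ _ (subgroup_preimage (topquot_map N) (subgroup_span _))).
    by move=> y yb; apply: sub_span; rewrite /= map_f.
  exact.
have clN : closed [set` N].
  have -> : [set` N] = (fun x : T => x *+ n) @^-1` [set 0].
    by apply/seteqP; split => x; [move=> /eqP|move=> /= x0; apply/eqP].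
  apply: preimage_closed; last first.
    apply: accessible_closed_set1; apply: hausdorff_accessible.
    exact: group_topology_hausdorff.
  by move=> x _; exact: continuous_mulrn.
move=> x; apply/eqP; have := @topquot_indiscrete T N _ iQ x; apply.
by move=> y; rewrite -((closure_id _).1 clN).
Qed.

(** * Neighbourhood bases of SSGP topologies *)

Section Bases.
Variable G : zmodType.
Implicit Types (S : set G) (U : nat -> set G).

(** A countable base at zero for a Hausdorff SSGP group topology on [S]. In [base_Cyc] one index
    serves both for the neighbourhood and for the error, which suffices because the sets
    decrease. *)
Record SSGP_base S U : Prop := SSGPBase {
  base_sub : forall n, U n `<=` S;
  base0 : forall n, U n 0;
  baseN : forall n x, U n x -> U n (- x);
  baseD : forall n x y, U n.+1 x -> U n.+1 y -> U n (x + y);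
  base_separated : forall x, (forall n, U n x) -> x = 0;
  base_Cyc : forall n x, S x -> exists2 y, span (Cyc (U n)) y & U n (x - y)
}.

Definition has_SSGP_base S : Prop := exists U, SSGP_base S U.

Lemma base_leq S U m n : SSGP_base S U -> (m <= n)%N -> U n `<=` U m.
Proof.
move=> bU; elim: n => [|n IHn]; first by rewrite leqn0 => /eqP ->.
rewrite leq_eqVlt => /predU1P[-> //|/IHn nm] x Ux; apply: nm.
by rewrite -(addr0 x); apply: (baseD bU) => //; exact: base0 bU _.
Qed.

Lemma CycS (A B : set G) : A `<=` B -> Cyc A `<=` Cyc B.
Proof. by move=> AB x /CycP Ax; apply/CycP => k; exact: AB. Qed.

(** The product topology; as the sum is direct, separation can be checked on components. *)
Lemma has_SSGP_base_setadd S1 S2 : subgroup S1 -> subgroup S2 ->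
  (forall x, S1 x -> S2 x -> x = 0) ->
  has_SSGP_base S1 -> has_SSGP_base S2 -> has_SSGP_base (setadd S1 S2).
Proof.
move=> sS1 sS2 S12 [U1 b1] [U2 b2]; exists (fun n => setadd (U1 n) (U2 n)).
have uniq_add x1 x2 y1 y2 : S1 x1 -> S1 y1 -> S2 x2 -> S2 y2 ->
    x1 + x2 = y1 + y2 -> x1 = y1.
  move=> S1x S1y S2x S2y E; apply/eqP; rewrite -subr_eq0; apply/eqP; apply: S12.
    exact: subgroupB.
  suff -> : x1 - y1 = y2 - x2 by exact: subgroupB.
  by apply/eqP; rewrite subr_eq addrAC eq_sym subr_eq addrC E.
split.
- by move=> n _ [x [y [/(base_sub b1) Sx /(base_sub b2) Sy ->]]]; exists x, y.
- by move=> n; exists 0, 0; rewrite addr0; split => //; [exact: base0 b1 _|exact: base0 b2 _].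
- move=> n _ [x [y [Ux Uy ->]]]; exists (- x), (- y); rewrite opprD.
  by split => //; [exact: baseN b1 _ _ _|exact: baseN b2 _ _ _].
- move=> n _ _ [x [y [Ux Uy ->]]] [x' [y' [Ux' Uy' ->]]].
  exists (x + x'), (y + y'); rewrite addrACA.
  by split => //; [exact: baseD b1 _ _ _ _ _|exact: baseD b2 _ _ _ _ _].
- move=> z Uz; have [x [y [Ux Uy zE]]] := Uz 0%N.
  have x0 : x = 0.
    apply: (base_separated b1) => n; have [x' [y' [Ux' Uy' zE']]] := Uz n.
    suff -> : x = x' by [].
    by apply: (uniq_add x y x' y'); rewrite -?zE //;
      [exact: base_sub b1 _ _ Ux|exact: base_sub b1 _ _ Ux'|
       exact: base_sub b2 _ _ Uy|exact: base_sub b2 _ _ Uy'].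
  rewrite zE x0 add0r; apply: (base_separated b2) => n.
  have [x' [y' [Ux' Uy' zE']]] := Uz n; suff -> : y = y' by [].
  apply: (@addrI _ x); rewrite -zE zE'; congr (_ + _).
  by apply/esym; apply: (uniq_add x y x' y'); rewrite -?zE //;
    [exact: base_sub b1 _ _ Ux|exact: base_sub b1 _ _ Ux'|
     exact: base_sub b2 _ _ Uy|exact: base_sub b2 _ _ Uy'].
- move=> n _ [x1 [x2 [Sx1 Sx2 ->]]].
  have [y1 Cy1 Uy1] := base_Cyc b1 n Sx1; have [y2 Cy2 Uy2] := base_Cyc b2 n Sx2.
  exists (y1 + y2); last by exists (x1 - y1), (x2 - y2); rewrite opprD addrACA.
  apply: (subgroupD (subgroup_span _)).
    by apply: spanS Cy1; apply: CycS; apply: setadd_subl; exact: base0 b2 _.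
  by apply: spanS Cy2; apply: CycS; apply: setadd_subr; exact: base0 b1 _.
Qed.

(** * The group topology defined by a base *)

Section Topology.
Variable U : nat -> set G.
Hypothesis bU : SSGP_base setT U.

Definition base_open (O : set G) : Prop :=
  forall x, O x -> exists n, forall u, U n u -> O (x + u).

Lemma base_openT : base_open setT. Proof. by move=> x _; exists 0%N. Qed.

Lemma base_openI : setI_closed base_open.
Proof.
move=> A B oA oB x [/oA[m mA] /oB[n nB]]; exists (maxn m n) => u Uu.
by split; [apply: mA|apply: nB]; apply: (base_leq bU) Uu; rewrite ?leq_maxl ?leq_maxr.
Qed.

Lemma base_open_bigU (I : Type) (f : I -> set G) :
  (forall i, base_open (f i)) -> base_open (\bigcup_i f i).
Proof.
move=> of_ x [i _ /of_[n nf]]; exists n => u Uu; exists i => //; exact: nf.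
Qed.

Definition base_topology : isOpenTopological G :=
  isOpenTopological.Build G base_openT base_openI base_open_bigU.

Local Notation T := (retopologize base_topology).

Lemma base_nbhs (x : T) (A : set T) :
  nbhs x A <-> exists n, forall u, U n u -> A (x + u).
Proof.
rewrite nbhsE; split=> [[B [oB Bx] BA]|[n nA]].
  by have [n nB] := oB x Bx; exists n => u /nB /BA.
(* The interior of [A]. *)
exists [set y | exists m, forall u, U m u -> A (y + u)].
  split; last by exists n.
  move=> y [m mA]; exists m.+1 => u Uu; exists m.+1 => v Uv.
  by rewrite -addrA; apply: mA; exact: (baseD bU).
by move=> y [m mA]; rewrite -[y]addr0; apply: mA; exact: base0 bU _.
Qed.

Lemma base_add_continuous : continuous (fun x : T * T => x.1 + x.2).
Proof.
move=> [x y] A /base_nbhs[n nA].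
exists ([set z | exists2 u, U n.+1 u & z = x + u], [set z | exists2 u, U n.+1 u & z = y + u]).
  by split; apply/base_nbhs; exists n.+1 => u Uu; exists u.
move=> [_ _] /= [[u Uu ->] [v Uv ->]].
by rewrite /= addrACA; apply: nA; exact: (baseD bU).
Qed.

Lemma base_opp_continuous : continuous (-%R : T -> T).
Proof.
move=> x A /base_nbhs[n nA]; apply/base_nbhs; exists n => u Uu.
by rewrite /= opprD; apply: nA; exact: (baseN bU).
Qed.

Lemma base_hausdorff : hausdorff_space T.
Proof.
move=> x y xy; apply/eqP; rewrite -subr_eq0; apply/eqP; apply: (base_separated bU) => n.
have [_ [[u Uu ->] [v Uv E]]] := xy [set z | exists2 u, U n.+1 u & z = x + u]
  [set z | exists2 u, U n.+1 u & z = y + u]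
  ((base_nbhs _ _).2 (ex_intro _ n.+1 (fun u Uu => ex_intro2 _ _ u Uu erefl)))
  ((base_nbhs _ _).2 (ex_intro _ n.+1 (fun u Uu => ex_intro2 _ _ u Uu erefl))).
have -> : (x : G) - y = v - u.
  by apply/eqP; rewrite subr_eq addrAC eq_sym subr_eq addrC -E.
by apply: (baseD bU) => //; exact: (baseN bU).
Qed.

Lemma base_admits_SSGP : admits_SSGP G.
Proof.
exists (GroupTopology base_add_continuous base_opp_continuous base_hausdorff).
move=> V /base_nbhs[m mV] O [x Ox] oO.
have [n nO] := oO x Ox.
(* One index fine enough for both purposes: [Cyc] lands in [Cyc V], and the error keeps [y] in
   [O]. *)
have [y Cy Uy] := base_Cyc bU (maxn m n) (I : [set: G] x).
exists y; split.
  have -> : y = (x : G) + - ((x : G) - y) by rewrite opprB addrC subrK.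
  by apply: nO; apply: (baseN bU); apply: (base_leq bU) Uy; exact: leq_maxr.
apply: spanS Cy; apply: CycS => u Uu; rewrite -[u]add0r; apply: mV.
by apply: (base_leq bU) Uu; exact: leq_maxl.
Qed.

End Topology.

(* The group [S] is generated by elements [z] that occur as targets [g j] of *)
(* arbitrarily large levels [lev j], and [g j] is the sum of [2 ^ lev j] elements *)
(* [x j i] up to an error [err j].  In the n-th neighbourhood of zero multiples *)
(* of the [x j i] are cheap, but not all [x j i] with the same [j] may be used *)
(* together with [err j].  This topology is Hausdorff because the [x j i] are *)
(* fresh, as witnessed by the subgroups [Z j i], which contain everything of *)
(* level at most [lev j] but [x j i]. *)
Section FreshElements.
Variables (S : set G) (J : eqType) (lev : J -> nat) (g : J -> G) (x : J -> nat -> G).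
Variables (Z : J -> nat -> set G) (A : nat -> set G).

Local Notation t j := (2 ^ lev j)%N.
Definition err j : G := g j - \sum_(i < t j) x j i.

Hypothesis sS : subgroup S.
Hypothesis Sx : forall j i, (i < t j)%N -> S (x j i).
Hypothesis Sg : forall j, S (g j).
Hypothesis sZ : forall j i, subgroup (Z j i).
Hypothesis sA : forall n, subgroup (A n).
Hypothesis A_dec : forall m n, (m <= n)%N -> A n `<=` A m.
Hypothesis A_cap : forall z, (forall n, A n z) -> z = 0.
Hypothesis Z_x : forall j i j' i', (i < t j)%N -> (i' < t j')%N ->
  (j, i) != (j', i') -> Z j i (x j' i').
Hypothesis Z_g : forall j i j', (lev j' <= lev j)%N -> (i < t j)%N -> Z j i (g j').
Hypothesis Z_large : forall z, S z ->
  exists N, forall j i, (N <= lev j)%N -> (i < t j)%N -> Z j i z.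
Hypothesis Z_multiple : forall j i (l : int), (i < t j)%N -> Z j i (x j i *~ l) ->
  A (lev j) (x j i *~ l).
Hypothesis Z_err : forall j i (l : int), (i < t j)%N -> (`|l| <= t j)%N ->
  Z j i (x j i *~ l) -> err j *~ l = 0.
Hypothesis S_gen : S `<=` span [set z | forall N, exists2 j, (N <= lev j)%N & g j = z].

(** A nonzero coefficient at [x j i] costs [1] whatever its value, so that the whole cyclic subgroup
    of [x j i] is small; multiples of [err j] are charged by the size of the coefficient. *)
Definition cost j (k : nat -> int) (l : int) : nat :=
  (\sum_(i < t j) (k i != 0%R) + `|l|)%N.

Definition term j (k : nat -> int) (l : int) : G :=
  \sum_(i < t j) x j i *~ k i + err j *~ l.

(** The cost relative to [t j] is at most [2^-N], separately for each [j]. The coefficients vanish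
    outside [s], so that representations over different lists can be added. *)
Definition fresh_base N : set G := [set z | exists (s : seq J) k l, [/\ uniq s,
  forall j, j \notin s -> (forall i, k j i = 0) /\ l j = 0,
  forall j, (cost j (k j) (l j) * 2 ^ N <= t j)%N &
  z = \sum_(j <- s) term j (k j) (l j)]].

Lemma term0 j k l : (forall i, k i = 0) -> l = 0 -> term j k l = 0.
Proof.
move=> k0 ->; rewrite /term mulr0z addr0 big1 // => i _.
by rewrite k0 mulr0z.
Qed.

Lemma sum_term_ext (s s' : seq J) k l : uniq s -> uniq s' -> {subset s <= s'} ->
  (forall j, j \notin s -> (forall i, k j i = 0) /\ l j = 0) ->
  \sum_(j <- s) term j (k j) (l j) = \sum_(j <- s') term j (k j) (l j).
Proof.
move=> us us' ss' kl0; rewrite [RHS](bigID (mem s)) /= [X in _ = _ + X]big1 ?addr0.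
  rewrite -[RHS]big_filter; apply: perm_big; apply: uniq_perm => //; first exact: filter_uniq.
  by move=> j; rewrite mem_filter; case: (boolP (j \in s)) => //= /ss' ->.
by move=> j /kl0[k0 l0]; exact: term0.
Qed.

Lemma cost0 j k l : (forall i, k i = 0) -> l = 0 -> cost j k l = 0%N.
Proof. by move=> k0 ->; rewrite /cost big1 // => i _; rewrite k0 eqxx. Qed.

Lemma fresh_base1 N j k l : (cost j k l * 2 ^ N <= t j)%N -> fresh_base N (term j k l).
Proof.
move=> c; exists [:: j], (fun j' => if j' == j then k else fun=> 0),
  (fun j' => if j' == j then l else 0); split => //; last by rewrite big_seq1 eqxx.
  by move=> j'; rewrite inE => /negbTE ->.
move=> j'; case: eqVneq => [-> //|_]; by rewrite cost0.
Qed.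

Lemma S_err j : S (err j).
Proof.
apply: (subgroupB sS) => //; apply: (subgroup_sum sS) => i _; exact: Sx.
Qed.

Lemma S_term j k l : S (term j k l).
Proof.
apply: (subgroupD sS); last by apply: (subgroupMz sS); exact: S_err.
by apply: (subgroup_sum sS) => i _; apply: (subgroupMz sS); exact: Sx.
Qed.

Lemma fresh_sub N : fresh_base N `<=` S.
Proof.
move=> _ [s [k [l [_ _ _ ->]]]]; apply: (subgroup_sum sS) => j _; exact: S_term.
Qed.

(** In a representation of [z] of index [N], working modulo [Z j i] isolates the contributions of
    [x j i] and [err j]. The errors vanish from the highest level downwards; then the multiples of
    each [x j i] lie in [Z j i], hence in [A N], for arbitrarily large [N]. *)
Lemma fresh_sep z : (forall N, fresh_base N z) -> z = 0.
Proof.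
move=> Uz; have Sz : S z := fresh_sub (Uz 0%N).
have [N0 ZN0] := Z_large Sz; apply: A_cap => N1.
pose N := maxn N0 N1; have [s [k [l [us kl0 costs zE]]]] := Uz N.
apply: (A_dec (leq_maxr N0 N1)); rewrite -/N.
(* Below level [N] the inequality [t j < 2 ^ N] leaves room only for the cost zero. *)
have small j : (lev j < N)%N -> (forall i, (i < t j)%N -> k j i = 0) /\ l j = 0.
  move=> jN; have : cost j (k j) (l j) = 0%N.
    apply/eqP; rewrite -leqn0 leqNgt; apply/negP => c0.
    have := costs j; rewrite leqNgt => /negP; apply.
    apply: (@leq_trans (2 ^ N)); last by rewrite leq_pmull.
    by rewrite ltn_exp2l.
  move=> /eqP; rewrite addn_eq0 => /andP[/eqP k0 /eqP l0]; split; last by lia.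
  move=> i it; move/eqP: k0; rewrite sum_nat_eq0 => /forallP /(_ (Ordinal it)) /=.
  by rewrite eqb0 negbK => /eqP.
have Zx j i : (i < t j)%N -> (forall j', j' \in s -> j' != j -> Z j i (err j' *~ l j')) ->
    j \in s -> (N <= lev j)%N -> Z j i (x j i *~ k j i + err j *~ l j).
  move=> it Ze js jN; have Zz : Z j i z.
    by apply: ZN0 => //; exact: leq_trans (leq_maxl _ _) jN.
  have Zrest : Z j i (\sum_(j' <- rem j s) term j' (k j') (l j')).
    apply: (subgroup_sum (sZ j i)) => j'; rewrite mem_rem_uniq // inE => /andP[j'j j's].
    apply: (subgroupD (sZ j i)); last exact: Ze.
    apply: (subgroup_sum (sZ j i)) => i' _; apply: (subgroupMz (sZ j i)).
    by apply: Z_x => //; rewrite xpair_eqE eq_sym (negbTE j'j).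
  have := subgroupB (sZ j i) Zz Zrest; rewrite zE (big_rem j) //= addrK.
  rewrite /term (bigD1 (Ordinal it)) //= -addrA addrCA => Z1.
  suff Z2 : Z j i (\sum_(i' < t j | i' != Ordinal it) x j i' *~ k j i').
    by have := subgroupB (sZ j i) Z1 Z2; rewrite addrAC subrr add0r.
  rewrite big_mkcond; apply: (subgroup_sum (sZ j i)) => i' _.
  case: ifPn => [i'i|_]; last exact: subgroup0 (sZ j i).
  apply: (subgroupMz (sZ j i)); apply: Z_x => //.
  by rewrite xpair_eqE eqxx /= eq_sym -(inj_eq val_inj) in i'i *.
have Zerr j i j' : (i < t j)%N -> j' != j -> (lev j' <= lev j)%N -> Z j i (err j').
  move=> it j'j levj; apply: (subgroupB (sZ j i)); first exact: Z_g.
  apply: (subgroup_sum (sZ j i)) => i' _; apply: Z_x => //.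
  by rewrite xpair_eqE eq_sym (negbTE j'j).
have err0 j : j \in s -> err j *~ l j = 0.
  (* Descending induction on the level: errors of higher level already vanish, and the other errors
     of level at most [lev j] are in [Z j i]. *)
  pose M := \max_(j <- s) lev j; move: {2}(M - lev j).+1 (ltnSn (M - lev j)) => n.
  elim: n j => // n IHn j jn js.
  have [->|lj0] := eqVneq (l j) 0; first by rewrite mulr0z.
  have jN : (N <= lev j)%N.
    by rewrite leqNgt; apply/negP => /small[_ lj]; rewrite lj eqxx in lj0.
  have cj : (cost j (k j) (l j) <= t j)%N.
    by apply: leq_trans (costs j); rewrite leq_pmulr // expn_gt0.
  have [i kji] : exists i : 'I_(t j), k j i == 0.
    apply/existsP; apply: contraTT cj => /existsPn ks; rewrite -ltnNge /cost.
    rewrite (eq_bigr (fun=> 1%N)) => [|i _]; last by rewrite ks.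
    by rewrite sum1_card card_ord -addn1 leq_add2l; lia.
  have := Zx j i (ltn_ord i) _ js jN; rewrite (eqP kji) mulr0z add0r => /(_ _) Ze.
  have {}Ze : Z j i (err j *~ l j).
    apply: Ze => j' j's j'j; have [le|lt] := leqP (lev j') (lev j).
      by apply: (subgroupMz (sZ j i)); exact: Zerr.
    rewrite IHn //; first exact: subgroup0 (sZ j i).
    have : (lev j' <= M)%N by exact: leq_bigmax_seq.
    by lia.
  apply: (Z_err (ltn_ord i)); first by apply: leq_trans cj; exact: leq_addl.
  (* Modulo [Z j i], [err j] is the opposite of [x j i]. *)
  have Zg : Z j i (g j *~ l j) by apply: (subgroupMz (sZ j i)); exact: Z_g.
  have := subgroupB (sZ j i) Zg Ze.
  rewrite -mulrzBl /err opprB addrCA subrr addr0 (bigD1 i) //= mulrzDl.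
  apply: (subgroupDr (sZ j i)); apply: (subgroupMz (sZ j i)).
  rewrite big_mkcond; apply: (subgroup_sum (sZ j i)) => i' _.
  case: ifPn => [i'i|_]; last exact: subgroup0 (sZ j i).
  by apply: Z_x => //; rewrite xpair_eqE eqxx /= eq_sym -(inj_eq val_inj) in i'i *.
rewrite zE; apply: (subgroup_sum (sA N)) => j js; rewrite /term err0 // addr0.
apply: (subgroup_sum (sA N)) => i _.
have [jN|jN] := ltnP (lev j) N.
  by have [-> // _] := small j jN; rewrite mulr0z; exact: subgroup0.
apply: (A_dec jN); apply: Z_multiple => //.
have := Zx j i (ltn_ord i) _ js jN; rewrite err0 // addr0; apply=> j' j's _.
by rewrite err0 //; exact: subgroup0.
Qed.

(** For density, [g j] is the sum of the [x j i], whose cyclic subgroups have cost at most [1], and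
    of [err j], of cost [1]; relative to [t j] these costs are small once [lev j] is large. *)
Lemma fresh_SSGP_base : SSGP_base S fresh_base.
Proof.
have baseD n z z' : fresh_base n.+1 z -> fresh_base n.+1 z' -> fresh_base n (z + z').
  move=> [s [k [l [us kl0 c ->]]]] [s' [k' [l' [us' kl0' c' ->]]]].
  exists (undup (s ++ s')), (fun j i => k j i + k' j i), (fun j => l j + l' j).
  split; first exact: undup_uniq.
  - move=> j; rewrite mem_undup mem_cat negb_or => /andP[/kl0[k0 l0] /kl0'[k0' l0']].
    by split=> [i|]; rewrite ?k0 ?k0' ?l0 ?l0' addr0.
  - move=> j; have cD : (cost j (fun i => k j i + k' j i)%R (l j + l' j)%R <=
        cost j (k j) (l j) + cost j (k' j) (l' j))%N.
      rewrite /cost addnACA; apply: leq_add; last by lia.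
      rewrite -big_split; apply: leq_sum => i _ /=.
      have nz (a b : int) : ((a + b != 0)%R <= (a != 0%R) + (b != 0%R))%N by lia.
      exact: nz.
    by have := c j; have := c' j; rewrite expnS; nia.
  - rewrite (@sum_term_ext s (undup (s ++ s'))) ?undup_uniq //; last first.
      by move=> j js; rewrite mem_undup mem_cat js.
    rewrite (@sum_term_ext s' (undup (s ++ s'))) ?undup_uniq //; last first.
      by move=> j js; rewrite mem_undup mem_cat js orbT.
    rewrite -big_split; apply: eq_bigr => j _ /=.
    rewrite /term addrACA -mulrzDr -big_split; congr (_ + _).
    by apply: eq_bigr => i _; rewrite mulrzDr.
have base0 n : fresh_base n 0.
  exists [::], (fun _ _ => 0), (fun=> 0); split => //; last by rewrite big_nil.
  by move=> j; rewrite cost0.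
have baseN n z : fresh_base n z -> fresh_base n (- z).
  move=> [s [k [l [us kl0 c ->]]]]; exists s, (fun j i => - k j i), (fun j => - l j).
  split => //.
  - by move=> j /kl0[k0 l0]; split=> [i|]; rewrite ?k0 ?l0 oppr0.
  - move=> j; have -> : cost j (fun i => - k j i) (- l j) = cost j (k j) (l j).
      by rewrite /cost abszN; congr (_ + _)%N; apply: eq_bigr => i _; rewrite oppr_eq0.
    exact: c.
  - rewrite -sumrN; apply: eq_bigr => j _; rewrite /term opprD mulrNz; congr (_ + _).
    by rewrite -sumrN; apply: eq_bigr => i _; rewrite mulrNz.
split => //; [exact: fresh_sub|exact: fresh_sep|].
have dec m n : (m <= n)%N -> fresh_base n `<=` fresh_base m.
  elim: n => [|n IHn]; first by rewrite leqn0 => /eqP ->.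
  rewrite leq_eqVlt => /predU1P[-> //|/IHn nm] z Uz; apply: nm.
  by rewrite -(addr0 z); exact: baseD.
move=> n z /S_gen; move: n.
suff : span [set z | forall N, exists2 j, (N <= lev j)%N & g j = z] `<=`
    [set z | forall n, exists2 y, span (Cyc (fresh_base n)) y & fresh_base n (z - y)].
  by move=> + n + => /[apply]; exact.
apply: span_min.
  split=> [n|a b aP bP n].
    by exists 0; [exact: subgroup0 (subgroup_span _)|rewrite subr0].
  have [y Cy Uy] := aP n.+1; have [y' Cy' Uy'] := bP n.+1.
  exists (y - y'); last by rewrite opprD addrACA -opprD; apply: baseD => //; exact: baseN.
  by apply: (subgroupB (subgroup_span _)); [apply: spanS Cy|apply: spanS Cy'];
    apply: CycS; exact: dec.
move=> w wP n; have [j nj <-] := wP n.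
exists (\sum_(i < t j) x j i).
  apply: (subgroup_sum (subgroup_span _)) => i _; apply: sub_span; apply/CycP => l.
  have -> : x j i *~ l = term j (fun i' => if i' == i then l else 0) 0.
    rewrite /term mulr0z addr0 (bigD1 i) //= eqxx big1 ?addr0 // => i' i'i.
    by rewrite (inj_eq val_inj) (negbTE i'i) mulr0z.
  apply: fresh_base1; apply: (@leq_trans (1 * 2 ^ n)); last by rewrite mul1n leq_exp2l.
  rewrite leq_pmul2r ?expn_gt0 // /cost addn0 (bigD1 i) //= big1 ?addn0 ?leq_b1 //.
  by move=> i' i'i; rewrite (inj_eq val_inj) (negbTE i'i) eqxx.
rewrite -/(err j); have -> : err j = term j (fun=> 0) 1.
  by rewrite /term mulr1z big1 ?add0r // => i _; rewrite mulr0z.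
apply: fresh_base1; rewrite /cost big1 => [|i _]; last by rewrite eqxx.
by rewrite add0n mul1n leq_exp2l.
Qed.

End FreshElements.

End Bases.

(** * Fresh elements in homogeneous and in countable groups *)

Section Homogeneous.
Variables (G : zmodType) (L : eqType) (D : set L) (q : nat) (b : L * nat -> G).

Let DT : set (L * nat) := D `*` setT.
Hypothesis ib : indep_mod b [set 0] q DT.
Hypothesis bq : forall u, DT u -> b u *+ q = 0.

Definition fresh_index (s n i : nat) : nat := pickle (s, n, i).

Definition fresh_height (s : nat) : nat :=
  if unpickle s is Some u then let: (_, n, _) := u : nat * nat * nat in n.+1 else 0%N.

Lemma fresh_heightE s n i : fresh_height (fresh_index s n i) = n.+1.
Proof. by rewrite /fresh_height /fresh_index pickleK. Qed.

Lemma fresh_index_inj s n i s' n' i' :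
  fresh_index s n i = fresh_index s' n' i' -> (s, n, i) = (s', n', i').
Proof. exact: (pcan_inj pickleK). Qed.

Lemma span_exponent x : span (b @` DT) x -> x *+ q = 0.
Proof.
move: x; apply: span_min => [|_ [u Du <-]]; last exact: bq.
by split=> [|x y /= xq yq]; rewrite ?mul0rn // mulrnBl xq yq subrr.
Qed.

(** Fresh elements are further members of the basis, and [Z j i] is spanned by the members other
    than [idx j i]. A multiple of [x j i] in [Z j i] is then zero, so the subgroups [A] can all be
    zero. *)
Lemma homogeneous_SSGP_base : has_SSGP_base (span (b @` DT)).
Proof.
pose S := span (b @` DT); have sS : subgroup S := subgroup_span _.
(* For the remaining triples [x] and [g] are zero and [Z] is everything, which makes the conditions
   trivial. *)
pose valid (j : L * nat * nat) := `[< D j.1.1 >] && (fresh_height j.1.2 <= j.2)%N.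
pose idx (j : L * nat * nat) i := (j.1.1, fresh_index j.1.2 j.2 i).
pose x j i := if valid j then b (idx j i) else 0.
pose g (j : L * nat * nat) := if valid j then b j.1 else 0.
pose Z j i := if valid j then span (b @` (DT `&` [set u | u != idx j i])) else setT.
have DTv j k : valid j -> DT (j.1.1, k) by case/andP => /asboolP.
have sZ j i : subgroup (Z j i).
  by rewrite /Z; case: ifP => // _; exact: subgroup_span.
have Zin j i u : DT u -> u <> idx j i -> Z j i (b u).
  move=> Du uj; rewrite /Z; case: ifP => // vj; apply: sub_span; exists u => //.
  by split => //; exact/eqP.
have Zl j i (l : int) : valid j -> Z j i (b (idx j i) *~ l) -> (q %| l)%Z.
  move=> vj; rewrite /Z vj => Zl.
  have sx : span (b @` [set u | DT u /\ u \notin [:: idx j i]]) (- (b (idx j i) *~ l)).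
    apply: (subgroupN (subgroup_span _)); apply: spanS Zl => _ [u [Du uj] <-].
    by exists u => //; split => //; rewrite inE.
  apply: (indep_mod_span (s := [:: idx j i]) (c := fun=> l) (subgroup_set0 G) ib _ _ sx) => //.
  - by move=> u /=; rewrite inE => /eqP ->; exact: DTv.
  - by rewrite /lincomb big_seq1 subrr.
  - exact: mem_head.
exists (fresh_base (fun j => j.2) g x).
apply: (@fresh_SSGP_base _ S _ (fun j => j.2) g x Z (fun=> [set 0])) => //.
- move=> j i _; rewrite /x; case: ifP => vj; last exact: subgroup0 sS.
  by apply: sub_span; exists (idx j i) => //; exact: DTv.
- move=> j; rewrite /g; case: ifP => vj; last exact: subgroup0 sS.
  by apply: sub_span; exists j.1 => //; case: j vj => -[u s] n; exact: DTv.
- by move=> n; exact: subgroup_set0.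
- by move=> m n _ y.
- by move=> z /(_ 0%N).
- move=> j i j' i' _ _ ji; rewrite /x; case: ifP => vj'; last exact: subgroup0.
  apply: Zin; first exact: DTv.
  case=> E /fresh_index_inj[E1 E2 E3]; move/eqP: ji; apply.
  by case: j j' E E1 E2 {vj'} => [[u s] n] [[u' s'] n'] /= -> -> ->; rewrite E3.
- move=> j i j' jj' _; rewrite /g; case: ifP => vj'; last exact: subgroup0.
  apply: Zin; first by case: j' vj' {jj'} => -[u s] n; exact: DTv.
  by move=> E; case/andP: vj' => _; rewrite E /= fresh_heightE => /leq_trans /(_ jj'); rewrite ltnn.
- move=> z /spanP[s [c [us sD ->]]]; exists (\max_(u <- s) fresh_height u.2) => j i jN _.
  apply: (subgroup_sum (sZ j i)) => u su; apply: (subgroupMz (sZ j i)).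
  apply: Zin; first exact: sD.
  move=> E; have : (fresh_height u.2 <= j.2)%N.
    by apply: leq_trans jN; apply: (@leq_bigmax_seq _ s xpredT (fun u => fresh_height u.2)).
  by rewrite E /= fresh_heightE ltnn.
- move=> j i l _; rewrite /x; case: ifP => vj; last by rewrite mul0rz.
  move=> /(Zl _ _ _ vj)/dvdzP[m ->] /=.
  by rewrite mulrC mulrzA -pmulrn bq ?mul0rz //; exact: DTv.
- move=> j i l _ _; case vj : (valid j); last first.
    move=> _; rewrite /err /g /x vj big1 // subrr mul0rz //.
  rewrite /x vj => /(Zl _ _ _ vj)/dvdzP[m ->].
  rewrite mulrC mulrzA -pmulrn; suff -> : err (fun j => j.2) g x j *+ q = 0 by rewrite mul0rz.
  apply: span_exponent; apply: (S_err sS) => [j' i' _|j'].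
    rewrite /x; case: ifP => vj'; last exact: subgroup0 sS.
    by apply: sub_span; exists (idx j' i') => //; exact: DTv.
  rewrite /g; case: ifP => vj'; last exact: subgroup0 sS.
  by apply: sub_span; exists j'.1 => //; case: j' vj' => -[u s] n; exact: DTv.
- apply: spanS => _ [[u s] [Du _] <-] N; exists (u, s, maxn N (fresh_height s)).
    exact: leq_maxl.
  by rewrite /g /valid /= leq_maxr asboolT.
Qed.

End Homogeneous.

Section CountableGroup.
Variables (G : zmodType) (S : set G) (I : eqType) (v : I -> G) (a : seq I).
Hypothesis sS : subgroup S.
Hypothesis cS : countable S.
Hypothesis ua : uniq a.
Hypothesis ia : indep_mod v [set 0] 0 [set` a].
Local Notation A := (span (v @` [set` a])).
Hypothesis AS : A `<=` S.
Hypothesis tS : forall x, S x -> torsion_mod A x.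
Hypothesis primesS : forall N, exists p, [/\ (N < p)%N, prime p &
  exists z, [/\ S z, A (z *+ p) & ~ A z]].

Lemma exists_prime_sequence : exists (e : nat -> nat) (z : nat -> G), [/\ injective e,
  forall k, (k < e k)%N, forall k, prime (e k) &
  forall k, [/\ S (z k), A (z k *+ e k) & ~ A (z k)]].
Proof.
have ex_pz N : exists pz : nat * G, [/\ (N < pz.1)%N, prime pz.1 &
    [/\ S pz.2, A (pz.2 *+ pz.1) & ~ A pz.2]].
  by have [p [Np pp [z zP]]] := primesS N; exists (p, z).
have [pz pzP] := choice ex_pz.
pose y k := iter k (fun u : nat * G => pz u.1) (pz 0%N).
have ymono : {homo (fun k => (y k).1) : m n / (m < n)%N}.
  apply: homo_ltn => [? ? ?|k]; first exact: ltn_trans.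
  by case: (pzP (y k).1).
exists (fun k => (y k).1), (fun k => (y k).2).
have yP k : exists N, y k = pz N by case: k => [|k]; [exists 0%N|exists (y k).1].
split.
- move=> m n /= E; case: (ltngtP m n) => // /ymono; rewrite E ltnn //.
- elim=> [|k IHk]; first by case: (pzP 0%N).
  by apply: leq_ltn_trans IHk _; exact: ymono.
- by move=> k; have [N ->] := yP k; case: (pzP N).
- by move=> k; have [N ->] := yP k; case: (pzP N).
Qed.

(** A fresh element is built from an element of prime order [p j i] modulo [A], and [Z j i] consists
    of the elements whose order modulo [A] is prime to [p j i]. The descending subgroups are the
    multiples of [A] by [2 ^ n]; they intersect in zero because [A] is free. *)
Lemma countable_SSGP_base : has_SSGP_base S.
Proof.
have sA : subgroup A := subgroup_span _.
have [e [z [e_inj e_gt e_prime zP]]] := exists_prime_sequence.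
have /countable_injP[f f_inj] := cS.
have ex_h y : exists h, S y -> (0 < h)%N /\ A (y *+ h).
  have [Sy|nSy] := pselect (S y); last by exists 0%N.
  by have [k k0 Ak] := tS Sy; exists k.
have [h hP] := choice ex_h.
pose valid (j : G * nat) := `[< S j.1 >] && (h j.1 <= j.2)%N.
(* The power of two codes the level and the odd factor codes the target and [i], so that distinct
   triples with targets in [S] get distinct primes. As [c j i] exceeds [2 ^ j.2], so does the prime;
   hence it divides no nonzero coefficient of absolute value at most [2 ^ j.2]. *)
pose c (j : G * nat) (i : nat) := (2 ^ j.2 * (pickle (f j.1, i)).*2.+1).+1.
have c_ge j i : (2 ^ j.2 < c j i)%N by rewrite /c ltnS leq_pmulr.
have c_inj j i j' i' : c j i = c j' i' -> (f j.1, j.2, i) = (f j'.1, j'.2, i').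
  case=> E; have logE n m : logn 2 (2 ^ n * m.*2.+1) = n.
    rewrite lognM ?expn_gt0 // lognX logn_prime // eqxx muln1.
    by rewrite logn_coprime ?addn0 // coprime2n /= odd_double.
  have E2 : j.2 = j'.2 by rewrite -(logE j.2 (pickle (f j.1, i))) E logE.
  move: E; rewrite E2 => /eqP; rewrite eqn_pmul2l ?expn_gt0 // eqSS => /eqP /double_inj.
  by move=> /(pcan_inj pickleK)[-> ->].
pose p j i := e (c j i).
have p_gt j i : (2 ^ j.2 < p j i)%N := ltn_trans (c_ge j i) (e_gt _).
(* The factor [2 ^ j.2] puts the multiples of [x j i] that lie in [Z j i] into [2 ^ j.2] times
   [A]. *)
pose x j i := if valid j then z (c j i) *+ 2 ^ j.2 else 0.
pose g (j : G * nat) := if valid j then j.1 else 0.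
pose Z j i := if valid j then [set y | exists2 k, ~~ (p j i %| k)%N & A (y *+ k)] else setT.
have sZ j i : subgroup (Z j i).
  rewrite /Z; case: ifP => // _; split.
    exists 1%N; first by rewrite dvdn1 gtn_eqF // prime_gt1 // e_prime.
    by rewrite mul0rn; exact: subgroup0.
  move=> y y' [k pk Ak] [k' pk' Ak']; exists (k * k')%N.
    by rewrite Euclid_dvdM ?negb_or ?pk // e_prime.
  by rewrite mulrnBl mulrnA mulnC mulrnA; apply: (subgroupB sA); exact: (subgroupMn sA).
have vS j : valid j -> S j.1 by case/andP => /asboolP.
have Zl j i (l : int) : valid j -> Z j i (z (c j i) *+ 2 ^ j.2 *~ l) -> (p j i %| `|l|)%N.
  rewrite /Z => -> -[k pk Ak]; have [Sz Ap nA] := zP (c j i); rewrite -/(p j i) in Ap.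
  have pp : prime (p j i) := e_prime _.
  have : (p j i %| 2 ^ j.2 * `|l| * k)%N.
    apply: contraT; rewrite -prime_coprime // => co.
    case: nA; apply: (subgroup_coprime sA co Ap).
    have /(subgroup_absz sA) : A (z (c j i) *~ ((2 ^ j.2)%N%:Z * l * k%:Z)).
      by rewrite !mulrzA -!pmulrn.
    by rewrite !abszM.
  rewrite !Euclid_dvdM // (negbTE pk) orbF => /orP[|//].
  rewrite Euclid_dvdX // => /andP[/dvdn_leq pl2 _].
  have : (2 ^ j.2 < c j i < p j i)%N by rewrite c_ge e_gt.
  by have := pl2 isT; have := expn_gt0 2 j.2; lia.
exists (fresh_base (fun j => j.2) g x).
apply: (@fresh_SSGP_base _ S _ (fun j => j.2) g x Z
  (fun n => [set y | exists2 w, A w & y = w *+ 2 ^ n])) => //.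
- move=> j i _; rewrite /x; case: ifP => vj; last exact: subgroup0.
  by apply: (subgroupMn sS); case: (zP (c j i)).
- by move=> j; rewrite /g; case: ifP => vj; [exact: vS|exact: subgroup0].
- move=> n; split; first by exists 0; [exact: subgroup0|rewrite mul0rn].
  move=> _ _ [w Aw ->] [w' Aw' ->]; exists (w - w'); last by rewrite mulrnBl.
  exact: (subgroupB sA).
- move=> m n mn _ [w Aw ->]; exists (w *+ 2 ^ (n - m)); first exact: (subgroupMn sA).
  by rewrite -mulrnA -expnD subnK.
- move=> y yA; have [w Aw yw] := yA 0%N; rewrite expn0 mulr1n in yw; rewrite {}yw in yA *.
  have [l lE] : exists l, w = lincomb v a l.
    exact: spanP_on.
  rewrite lE /lincomb big_seq big1 // => u ua'.
  suff -> : l u = 0 by rewrite mulr0z.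
  (* The exponent is the absolute value of [l u]: a nonzero integer [l u] is not divisible by that
     power of two, which is larger. *)
  apply/eqP/negPn/negP => lu; have [w' Aw' wv] := yA `|l u|%N.
  have [m mE] : exists m, w' = lincomb v a m.
    exact: spanP_on.
  have : lincomb v a (fun y => l y - m y * (2 ^ `|l u|)%N%:Z) = 0 -> False.
    move=> /(ia ua (@subset_refl _ _)) /(_ u ua'); rewrite dvd0z subr_eq0 => /eqP lm.
    have m0 : m u != 0 by apply: contra_neq lu => m0; rewrite lm m0 mul0r.
    have := ltn_expl `|l u| (ltnSn 1); rewrite {1}lm abszM /= ltnNge => /negP; apply.
    by rewrite leq_pmull // absz_gt0.
  apply; have : lincomb v a l - lincomb v a m *~ (2 ^ `|l u|)%N%:Z = 0.
    by rewrite -mE -pmulrn -wv lE subrr.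
  by rewrite lincombMz lincombB.
- move=> j i j' i' _ _ ji; rewrite /x; case: ifP => vj'; last exact: subgroup0 (sZ _ _).
  apply: (subgroupMn (sZ _ _)); rewrite /Z; case: ifP => // vj; exists (p j' i').
    rewrite dvdn_prime2 ?e_prime //; apply: contra ji => /eqP /e_inj /c_inj[E1 E2 E3].
    have {}E1 := f_inj _ _ (mem_set (vS _ vj)) (mem_set (vS _ vj')) E1.
    by case: j j' E1 E2 {vj vj'} => [u n] [u' n'] /= -> ->; rewrite E3.
  by case: (zP (c j' i')).
- move=> j i j' jj' _; rewrite /g; case: ifP => vj'; last exact: subgroup0 (sZ _ _).
  rewrite /Z; case: ifP => // vj; have [h0 Ah] := hP _ (vS _ vj').
  exists (h j'.1) => //; rewrite gtnNdvd //.
  case/andP: vj' => _ hj'; apply: leq_ltn_trans hj' _; apply: leq_ltn_trans jj' _.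
  exact: ltn_trans (ltn_expl _ _) (p_gt j i).
- move=> y Sy; have [h0 Ah] := hP _ Sy; exists (h y) => j i yj _.
  rewrite /Z; case: ifP => // vj; exists (h y) => //; rewrite gtnNdvd //.
  by apply: leq_ltn_trans yj _; exact: ltn_trans (ltn_expl _ _) (p_gt j i).
- move=> j i l _; rewrite /x; case: ifP => vj; last first.
    by move=> _; exists 0; [exact: subgroup0|rewrite !mul0rn mul0rz].
  move=> /(Zl _ _ _ vj) pl; have [_ Ap _] := zP (c j i).
  have [m lE] : exists m, l = (p j i)%:Z * m.
    by exists (l %/ p j i)%Z; rewrite mulrC divzK // dvdzE.
  exists (z (c j i) *+ p j i *~ m); first exact: (subgroupMz sA).
  by rewrite lE !pmulrn -!mulrzA; congr (_ *~ _); rewrite mulrC -mulrA.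
- move=> j i l _ lj; rewrite /x; case: ifP => vj; last first.
    by move=> _; rewrite /err /g /x vj big1 // subrr mul0rz.
  move=> /(Zl _ _ _ vj) /dvdn_leq; have [->|l0] := eqVneq l 0; first by rewrite mulr0z.
  by rewrite absz_gt0 l0 => /(_ isT) /leq_trans /(_ lj) /leq_ltn_trans /(_ (p_gt j i)); rewrite ltnn.
- move=> w Sw; apply: sub_span => N; exists (w, maxn N (h w)); first exact: leq_maxl.
  by rewrite /g /valid /= leq_maxr asboolT.
Qed.

End CountableGroup.

(** * Splitting off homogeneous summands *)

Section Decomposition.
Variable G : zmodType.
Implicit Types S K N : set G.

(** A relative form of the splitting of bounded pure subgroups: a maximal subgroup over [N] that
    meets [K] trivially is a complement. The last hypothesis takes the place of purity. *)
Lemma ex_complement S K N n : (0 < n)%N -> subgroup S -> subgroup K -> subgroup N ->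
  K `<=` S -> N `<=` S -> (forall x, S x -> N (x *+ n)) ->
  (forall x, K x -> N x -> x = 0) ->
  (forall p x, prime p -> (p %| n)%N -> K x -> x *+ (n %/ p) = 0 ->
    exists2 y, K y & x = y *+ p) ->
  exists S', [/\ subgroup S', N `<=` S', S' `<=` S,
    forall x, K x -> S' x -> x = 0 & S = setadd K S'].
Proof.
move=> n0 sS sK sN KS NS Nn KN0 Kdiv.
(* Speaking of the union with [N] lets the empty set, which is the union of the empty chain,
   qualify. *)
pose P X := [/\ subgroup (N `|` X), X `<=` S & forall x, K x -> (N `|` X) x -> x = 0].
have [|X [[sX XS KX0] Xmax]] := @Zorn_bigcup G P.
  move=> F FP tF; split.
  - split=> [|x y]; first by left; exact: subgroup0.
    have sub X z : F X -> (N `|` X) z -> (N `|` \bigcup_(Y in F) Y) z.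
      by move=> FX [Nz|Xz]; [left|right; exists X].
    move=> [Nx|[X1 FX1 X1x]] [Ny|[X2 FX2 X2y]].
    + by left; exact: subgroupB.
    + have [s2 _ _] := FP _ FX2; apply: (sub X2) => //.
      by apply: (subgroupB s2); [left|right].
    + have [s1 _ _] := FP _ FX1; apply: (sub X1) => //.
      by apply: (subgroupB s1); [right|left].
    + have [s1 _ _] := FP _ FX1; have [s2 _ _] := FP _ FX2.
      have [X12|X21] := tF _ _ FX1 FX2.
        by apply: (sub X2) => //; apply: (subgroupB s2); right => //; exact: X12.
      by apply: (sub X1) => //; apply: (subgroupB s1); right => //; exact: X21.
  - by move=> x [X /FP[_ XS _] /XS].
  - move=> x Kx [Nx|[X FX Xx]]; first exact: KN0.
    by have [_ _ KX0] := FP _ FX; apply: KX0 => //; right.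
pose S' := N `|` X; have S'S : S' `<=` S by move=> x [/NS|/XS].
have NS' : N `<=` S' by move=> x; left.
exists S'; split => //; pose T := setadd K S'; have sT : subgroup T by exact: subgroup_setadd.
apply/seteqP; split; last first.
  by move=> _ [x [y [/KS Sx /S'S Sy ->]]]; exact: subgroupD.
move=> x0 Sx0; apply: contrapT => Tx0.
have S'T : S' `<=` T := setadd_subr (subgroup0 sK).
have exm : exists m, (0 < m)%N && `[< T (x0 *+ m) >].
  by exists n; rewrite n0; apply/asboolP; apply: S'T; apply: NS'; exact: Nn.
case: (ex_minnP exm) => m /andP[m0 /asboolP Tm] mmin.
have m1 : (1 < m)%N.
  by rewrite ltn_neqAle m0 andbT; apply/eqP => m1; rewrite -m1 in Tm.
have mn : (m %| n)%N.
  rewrite /dvdn -leqn0 leqNgt; apply/negP => r0.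
  have : (n %% m < m)%N by rewrite ltn_mod.
  rewrite ltnNge => /negP; case; apply: mmin; rewrite r0; apply/asboolP.
  apply: (@subgroupDr _ _ sT _ (x0 *+ (n %/ m * m))).
    by rewrite mulnC mulrnA; exact: (subgroupMn sT).
  by rewrite -mulrnDr addnC -divn_eq; apply: S'T; apply: NS'; exact: Nn.
have pp := pdiv_prime m1; set p := pdiv m in pp.
have pm : (p %| m)%N := pdiv_dvd m; have pn := dvdn_trans pm mn.
pose x := x0 *+ (m %/ p).
have nTx : ~ T x.
  move=> Tx; have : (m %/ p < m)%N by rewrite ltn_Pdiv // prime_gt1.
  rewrite ltnNge => /negP; apply; apply: mmin.
  by rewrite divn_gt0 ?prime_gt0 // dvdn_leq //=; apply/asboolP.
have Sx : S x by exact: subgroupMn.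
have [k [v [Kk S'v kv]]] : T (x *+ p) by rewrite -mulrnA divnK.
(* Since [x *+ n] is in [N], the multiple of [k] by [n %/ p] is in [K] and in [S'], hence zero. So
   [k] is divisible by [p] in [K], and correcting [x] accordingly gives [x'] with [x' *+ p] in
   [S']. *)
have [k' Kk' kE] : exists2 y, K y & k = y *+ p.
  apply: Kdiv => //; apply: KX0; first exact: subgroupMn.
  apply: (@subgroupDr _ _ sX _ (v *+ (n %/ p))); first exact: (subgroupMn sX).
  by rewrite -mulrnDl -kv -mulrnA mulnC divnK //; apply: NS'; exact: Nn.
pose x' := x - k'; have S'x' : S' (x' *+ p).
  by rewrite mulrnBl kv kE addrAC subrr add0r.
have nTx' : ~ T x'.
  move=> Tx'; apply: nTx; rewrite -(subrK k' x); apply: (subgroupD sT) => //.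
  exact: (setadd_subl (subgroup0 sX)).
pose Y := setadd S' (span [set x']).
have sY : subgroup Y by apply: subgroup_setadd => //; exact: subgroup_span.
have S'Y : S' `<=` Y := setadd_subl (subgroup0 (subgroup_span _)).
have NY : N `|` Y = Y by apply/setUidPr => z Nz; apply: S'Y; left.
have Yx' : Y x' by apply: (setadd_subr (subgroup0 sX)); exact: sub_span.
apply: (Xmax Y).
  split=> [z Xz|YX]; first by apply: S'Y; right.
  by apply: nTx'; apply: S'T; right; exact: YX.
split; rewrite ?NY //.
  move=> _ [s [_ [S's /span1P[l ->] ->]]]; apply: (subgroupD sS); first exact: S'S.
  by apply: (subgroupMz sS); apply: (subgroupB sS) => //; exact: KS.
(* If [p] divides [l], then [z] is in [S']. Otherwise [x'] would be in [T], because [x' *+ p] and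
   [x' *~ l] are. *)
move=> z Kz [s [_ [S's /span1P[l ->] zE]]].
have [/dvdzP[l' lE]|pl] := boolP (p %| l)%Z.
  apply: KX0 => //; rewrite zE; apply: (subgroupD sX) => //.
  by rewrite lE mulrC mulrzA -pmulrn; exact: (subgroupMz sX).
case: nTx'; apply: (@subgroup_coprime _ T x' p `|l|%N sT).
- by rewrite prime_coprime.
- exact: S'T.
- apply: (subgroup_absz sT); rewrite (_ : x' *~ l = z - s); last by rewrite zE addrAC subrr add0r.
  by apply: (subgroupB sT); [exact: (setadd_subl (subgroup0 sX))|exact: S'T].
Qed.

(** The families below consist of whole sequences, so that each member contributes infinitely many
    basis elements, in the form used by [homogeneous_SSGP_base]. *)
Definition seq_eval (u : (nat -> G) * nat) : G := u.1 u.2.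

(* Splits off from [S] a direct sum of copies of [(Z/q)^(nat)], [q] being the *)
(* [p]-part of [n], so that multiplication by [n/p] has a countable image on *)
(* what remains. *)
Section Step.
Variables (S : set G) (n p : nat).
Hypothesis sS : subgroup S.
Hypothesis n_gt1 : (1 < n)%N.
Hypothesis p_pr : prime p.
Hypothesis p_dvd : (p %| n)%N.
Let N : set G := (fun x => x *+ n) @` S.
Hypothesis cN : countable N.
Local Notation q := (p ^ logn p n)%N.

Let sN : subgroup N.
Proof.
split; first by exists 0; [exact: subgroup0|rewrite mul0rn].
move=> _ _ [x Sx <-] [y Sy <-]; exists (x - y); last by rewrite mulrnBl.
exact: subgroupB.
Qed.

Let NS : N `<=` S. Proof. by move=> _ [x Sx <-]; exact: subgroupMn. Qed.

Let n_fact : exists2 m, coprime p m & n = (m * q)%N.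
Proof. by have [m pm nE] := pfactor_coprime p_pr (ltnW n_gt1); exists m. Qed.

Let q_fact : q = (p * p ^ (logn p n).-1)%N.
Proof. by rewrite -expnS prednK // logn_gt0 mem_primes p_pr (ltnW n_gt1). Qed.

Let np_fact m : n = (m * q)%N -> (n %/ p = m * p ^ (logn p n).-1)%N.
Proof. by move=> {1}->; rewrite q_fact mulnCA mulKn // prime_gt0. Qed.

Definition admissible (D : set (nat -> G)) : Prop :=
  (forall s i, D s -> S (s i) /\ s i *+ q = 0) /\
  indep_mod seq_eval N q (D `*` setT).

Lemma ex_max_admissible : exists D, admissible D /\
  forall D', D `<` D' -> ~ admissible D'.
Proof.
apply: Zorn_bigcup => F FP tF; split.
  by move=> s i [D /FP[DP _] /DP].
move=> u c uu uF Nu i iu.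
have [|u0|[D FD Du]] := @chain_finite _ F (map fst u) tF.
- by move=> s /InE /mapP[v /uF[Fv _] ->].
- by case: (u) u0 iu.
- have [_ iD] := FP _ FD; apply: iD uu _ Nu i iu => v vu; split => //.
  by apply: Du; apply/InE; exact: map_f.
Qed.

(** If [q] did not divide [c], their greatest common divisor would divide [q %/ p], and a Bezout
    relation would bring [x *+ (q %/ p)] into [C]. *)
Lemma multiple_coprime_qpart (C : set G) x (c : int) : subgroup C -> x *+ q = 0 ->
  C (x *~ c) -> ~ C (x *+ (q %/ p)) -> (q %| c)%Z.
Proof.
move=> sC xq Cc nC; apply: contrapT => /negP; rewrite dvdzE /= => qc.
have /(dvdn_pfactor _ _ p_pr)[j jq jE] : (gcdn `|c| q %| q)%N := dvdn_gcdr _ _.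
have jlt : (j < logn p n)%N.
  rewrite ltn_neqAle jq andbT; apply: contra qc => /eqP jn; rewrite -jn -jE.
  exact: dvdn_gcdl.
apply: nC; have Cj : C (x *+ p ^ j).
  have [u [v uv]] := Bezoutz c q%:Z.
  rewrite pmulrn -jE; have -> : (gcdn `|c| q)%:Z = c * u + q%:Z * v.
    by rewrite ![_ * u]mulrC [_ * v]mulrC uv.
  by rewrite mulrzDr !mulrzA -pmulrn xq mul0rz addr0; exact: subgroupMz.
have -> : (q %/ p = p ^ j * p ^ ((logn p n).-1 - j))%N.
  rewrite -expnD subnKC; last by lia.
  by rewrite q_fact mulKn // prime_gt0.
by rewrite mulrnA; exact: (subgroupMn sC).
Qed.

(** [K] is spanned by a maximal admissible family and splits off by [ex_complement]. If
    multiplication by [n %/ p] had an uncountable image on the complement, one could choose there a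
    sequence whose members have order [q] modulo [N] and the earlier ones; it would enlarge the
    family. *)
Lemma ex_homogeneous_summand : exists K S', [/\ subgroup K, subgroup S',
  has_SSGP_base K, forall x, K x -> S' x -> x = 0 & S = setadd K S'] /\
  [/\ forall x, K x -> x *+ n = 0, S' `<=` S &
      countable ((fun x => x *+ (n %/ p)) @` S')].
Proof.
have [D [[DS iD] Dmax]] := ex_max_admissible.
have [m pm nE] := n_fact; have npE := np_fact nE.
have q0 : (0 < q)%N by rewrite expn_gt0 prime_gt0.
pose DT := D `*` [set: nat].
pose K := span (seq_eval @` DT); have sK : subgroup K := subgroup_span _.
have KS : K `<=` S.
  by apply: span_min => // _ [[s i] [Ds _] <-]; case: (DS s i Ds).
have iD0 : indep_mod seq_eval [set 0] q DT.
  by move=> u c uu uD u0; apply: iD => //; rewrite u0; exact: subgroup0 sN.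
have bq u : DT u -> seq_eval u *+ q = 0 by case: u => s i [Ds _]; case: (DS s i Ds).
have Kq := span_exponent bq.
have KN0 x : K x -> N x -> x = 0.
  move=> /spanP[u [c [uu uD ->]]] /(iD _ _ uu uD) qc.
  rewrite /lincomb big_seq big1 // => i iu; have /dvdzP[l ->] := qc i iu.
  by rewrite mulrC mulrzA -pmulrn bq ?mul0rz //; exact: uD.
have Kdiv l x : prime l -> (l %| n)%N -> K x -> x *+ (n %/ l) = 0 -> exists2 y, K y & x = y *+ l.
  move=> l_pr ln Kx xl; have [lp|lp] := eqVneq l p; last first.
    have : coprimez l q by rewrite coprimezE /= coprimeXr // primes_coprime.
    move=> /coprimezP[[u v] /= uv]; exists (x *~ u); first exact: (subgroupMz sK).
    rewrite -[LHS]mulr1z -uv mulrzDr [v * _]mulrC [X in _ + X]mulrzA -pmulrn Kq //.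
    by rewrite mul0rz addr0 mulrzA -pmulrn.
  rewrite {}lp {l l_pr ln} in xl *.
  move: Kx xl => /spanP[u [c [uu uD ->]]] /eqP.
  rewrite pmulrn lincombMz => /eqP E.
  have qc : {in u, forall i, (q %| c i * (n %/ p)%N%:Z)%Z}.
    by apply: iD => //; rewrite E; exact: subgroup0 sN.
  have pc : {in u, forall i, (p %| c i)%Z}.
    move=> i /qc; rewrite !dvdzE abszM /= npE q_fact mulnA dvdn_pmul2r; last first.
      by rewrite expn_gt0 prime_gt0.
    by rewrite Gauss_dvdl.
  exists (lincomb seq_eval u (fun i => (c i %/ p)%Z)); first exact: lincomb_span.
  rewrite pmulrn lincombMz; apply: eq_big_seq => i iu /=; congr (_ *~ _).
  by rewrite divzK // pc.
have [S' [sS' NS' S'S KS'0 SE]] := ex_complement (ltnW n_gt1) sS sK sN KS NS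
  (fun x Sx => ex_intro2 _ _ x Sx erefl) KN0 Kdiv.
exists K, S'; split; first by split => //; exact: homogeneous_SSGP_base iD0 bq.
split => // [x /Kq xq|]; first by rewrite nE mulnC mulrnA xq mul0rn.
apply: contrapT => ncS'.
(* Subtracting from [x] one of the countably many elements [r (x *+ n)] leaves an element killed by
   [n], whose multiple by [m] is killed by [q]. So a countable [C] cannot contain all the
   [b *+ (q %/ p)]. *)
have pick (C : set G) : subgroup C -> countable C ->
    exists2 b, S' b /\ b *+ q = 0 & ~ C (b *+ (q %/ p)).
  move=> sC cC; apply: contrapT => noC; apply: ncS'.
  have {}noC b : S' b -> b *+ q = 0 -> C (b *+ (q %/ p)).
    by move=> S'b bq'; apply: contrapT => nC; apply: noC; exists b.
  pose r y := xget 0 [set x | S' x /\ x *+ n = y].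
  apply: (@sub_countable _ _ _ (setadd C ((fun y => r y *+ (n %/ p)) @` N))); last first.
    by apply: countable_setadd => //; exact: countable_image.
  apply: subset_card_le => _ [x S'x <-].
  have [S'r rE] : [set y | S' y /\ y *+ n = x *+ n] (r (x *+ n)) by exact: (@xgetI _ _ _ x).
  exists ((x - r (x *+ n)) *+ (n %/ p)), (r (x *+ n) *+ (n %/ p)); split.
  - rewrite npE (_ : p ^ _ = (q %/ p))%N; last by rewrite q_fact mulKn // prime_gt0.
    rewrite mulrnA; apply: noC; first by apply: (subgroupMn sS'); exact: subgroupB.
    by rewrite -mulrnA -nE mulrnBl rE subrr.
  - by exists (x *+ n) => //; exists x => //; exact: S'S.
  - by rewrite -mulrnDl subrK.
have ex_next (l : seq G) : exists b, [/\ S' b, b *+ q = 0 &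
    ~ setadd (span [set` l]) N (b *+ (q %/ p))].
  have [||b [S'b bq'] nb] := pick (setadd (span [set` l]) N); last by exists b.
    by apply: subgroup_setadd => //; exact: subgroup_span.
  apply: countable_setadd => //; apply: countable_span.
  exact/finite_set_countable/finite_seq.
have [next nextP] := choice ex_next.
pose l i := iter i (fun l => next l :: l) [::].
pose s i := next (l i).
have sl i j : (i < j)%N -> s i \in l j.
  elim: j => // j IHj; rewrite ltnS leq_eqVlt /= inE => /predU1P[->|/IHj ->].
    by rewrite eqxx.
  by rewrite orbT.
have sP i : [/\ S' (s i), s i *+ q = 0 & ~ setadd (span [set` l i]) N (s i *+ (q %/ p))].
  exact: nextP.
(* Induction from the largest index: [s M] has order [q] modulo [N] and the earlier members, so [q]
   divides its coefficient and its term drops out. *)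
have indep_s M (v : seq nat) (c : nat -> int) : uniq v -> (forall i, i \in v -> (i < M)%N) ->
    N (\sum_(i <- v) s i *~ c i) -> {in v, forall i, (q %| c i)%Z}.
  elim: M v => [|M IHM] v uv vM Nv; first by move=> i /vM.
  have [Mv|Mv] := boolP (M \in v); last first.
    apply: IHM => // i iv; have := vM i iv; rewrite ltnS leq_eqVlt => /predU1P[iM|//].
    by rewrite -iM iv in Mv.
  have remM i : i \in rem M v -> (i < M)%N.
    rewrite mem_rem_uniq // inE => /andP[iM /vM]; rewrite ltnS leq_eqVlt.
    by rewrite (negbTE iM).
  have [S'M sMq nC] := sP M.
  have sC : subgroup (setadd (span [set` l M]) N).
    by apply: subgroup_setadd => //; exact: subgroup_span.
  have qcM : (q %| c M)%Z.
    apply: (multiple_coprime_qpart sC sMq) => //.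
    move: Nv; rewrite (big_rem M) //= => Nv.
    exists (- \sum_(i <- rem M v) s i *~ c i), (s M *~ c M + \sum_(i <- rem M v) s i *~ c i).
    split => //; last by rewrite addrC addrK.
    apply: (subgroupN (subgroup_span _)); apply: (subgroup_sum (subgroup_span _)) => i /remM iM.
    by apply: (subgroupMz (subgroup_span _)); apply: sub_span; exact: sl.
  move=> i iv; have [->//|iM] := eqVneq i M.
  apply: (IHM (rem M v)); [exact: rem_uniq|exact: remM| |by rewrite mem_rem_uniq // inE iM].
  move: Nv; rewrite (big_rem M) //=; case/dvdzP: qcM => k ->.
  by rewrite mulrC mulrzA -pmulrn sMq mul0rz add0r.
have sD : ~ D s.
  move=> Ds; have [S's0 _ nC] := sP 0%N; apply: nC.
  rewrite (KS'0 (s 0%N)) //; first by rewrite mul0rn; exact: subgroup0 (subgroup_setadd (subgroup_span _) sN).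
  by apply: sub_span; exists (s, 0%N).
apply: (Dmax (D `|` [set s])).
  by split=> [t Dt|sub]; [left|apply: sD; apply: sub; right].
split=> [t i [/DS //|->]|u c uu uD Nu].
  by have [S'i siq _] := sP i; split => //; exact: S'S.
pose u1 := [seq v <- u | v.1 != s]; pose v2 := [seq v.2 | v <- u & v.1 == s].
have uE : lincomb seq_eval u c = lincomb seq_eval u1 c + \sum_(i <- v2) s i *~ c (s, i).
  rewrite /lincomb (bigID (fun v : (nat -> G) * nat => v.1 == s)) /= addrC.
  rewrite big_filter; congr (_ + _); rewrite big_map big_filter.
  by apply: eq_bigr => -[t i] /= /eqP ->.
have u1D : [set` u1] `<=` DT.
  move=> [t i]; rewrite /= mem_filter /= => /andP[/eqP ts /uD[[Dt|//] _]]; split => //.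
have K1 : K (lincomb seq_eval u1 c) by exact: lincomb_span.
have S'2 : S' (\sum_(i <- v2) s i *~ c (s, i)).
  by apply: (subgroup_sum sS') => i _; apply: (subgroupMz sS'); case: (sP i).
(* This component is in [K] and also in [S'], because [N] and the other component are contained in
   [S']. *)
have u10 : lincomb seq_eval u1 c = 0.
  apply: KS'0 => //; apply: (subgroupDr sS' S'2); rewrite -uE; exact: NS'.
have N2 : N (\sum_(i <- v2) s i *~ c (s, i)) by move: Nu; rewrite uE u10 add0r.
move=> [t i] iu; have [ts|ts] := eqVneq t s; last first.
  apply: (iD u1 c) => //; first exact: filter_uniq.
    by rewrite u10; exact: subgroup0.
  by rewrite mem_filter /= ts.
rewrite {}ts in iu *; apply: (indep_s (\max_(j <- v2) j).+1 v2 (fun i => c (s, i))) => //.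
- rewrite map_inj_in_uniq ?filter_uniq // => -[t1 i1] [t2 i2].
  by rewrite !mem_filter /= => /andP[/eqP -> _] /andP[/eqP -> _] ->.
- by move=> j jv; rewrite ltnS; exact: (@leq_bigmax_seq _ v2 xpredT id).
- by apply/mapP; exists (s, i) => //; rewrite mem_filter eqxx.
Qed.

End Step.

(** Induction on [n], which becomes [n %/ p] when a homogeneous summand is split off. The countable
    case is assumed for every [S0] containing the multiples by [n], since the group left over is not
    known beforehand; the summand is killed by [n], so the containment survives. *)
Lemma SSGP_base_decomposition S n : (0 < n)%N -> subgroup S ->
  countable ((fun x => x *+ n) @` S) ->
  (forall S0, subgroup S0 -> countable S0 -> S0 `<=` S ->
    (forall x, S x -> S0 (x *+ n)) -> has_SSGP_base S0) ->
  has_SSGP_base S.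
Proof.
elim/ltn_ind: n S => n IHn S n0 sS cS base.
have [n1|n1] := leqP n 1.
  have nE : n = 1%N by lia.
  apply: base => // [|x Sx]; last exact: subgroupMn.
  by move: cS; rewrite nE image_id.
have pp := pdiv_prime n1; set p := pdiv n in pp.
have pn : (p %| n)%N := pdiv_dvd n.
have [K [S' [[sK sS' bK KS'0 SE] [Kn S'S cS']]]] := ex_homogeneous_summand sS n1 pp pn cS.
rewrite SE; apply: has_SSGP_base_setadd => //.
apply: (IHn (n %/ p)%N) => //.
- by rewrite ltn_Pdiv // prime_gt1.
- by rewrite divn_gt0 ?prime_gt0 // dvdn_leq.
move=> S0 sS0 cS0 S0S' S0n; apply: base => //; first exact: subset_trans S'S.
rewrite SE => _ [k [v [Kk S'v ->]]]; rewrite mulrnDl Kn // add0r.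
by rewrite -(divnK pn) mulrnA; apply: (subgroupMn sS0); exact: S0n.
Qed.

End Decomposition.

(** * The equivalence *)

Section RankLemmas.
Variable G : zmodType.
Implicit Types S B : set G.

Lemma independent_torsion d B : (d != 1)%N -> independent d B ->
  (forall x, B x -> x = 0) -> B = set0.
Proof.
move=> d1 iB B0; apply/seteqP; split=> // x Bx.
have /(_ x (mem_head _ _)) : {in [:: x], forall y, (d %| 1)%Z}.
  apply: (iB [:: x] (fun=> 1)) => //; last by rewrite big_seq1 (B0 x Bx) mul0rz.
  by move=> y /=; rewrite inE => /eqP ->.
by rewrite dvdzE /= dvdn1 (negbTE d1).
Qed.

Lemma rank_torsion : is_torsion G -> rank [set: G] #= sum_p_rank [set: G].
Proof.
move=> tG; have [_ iB _] := free_rank_max [set: G].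
have F0 : free_rank [set: G] = set0.
  apply/seteqP; split=> // x Bx; have /asboolP[k k0 xk] := tG x.
  have /(_ x (mem_head _ _)) : {in [:: x], forall y, (0 %| k%:Z)%Z}.
    apply: (iB [:: x] (fun=> k%:Z)) => //; last by rewrite big_seq1 -pmulrn.
    by move=> y /=; rewrite inE => /eqP ->.
  by rewrite dvd0z; lia.
rewrite /rank /card_max F0 card_ge0.
by apply: inj_card_eq => x y _ _ [].
Qed.

Lemma subgroup_multiples n : subgroup (multiples G n).
Proof.
split; first by exists 0 => //; rewrite mul0rn.
by move=> _ _ [x _ <-] [y _ <-]; exists (x - y) => //; rewrite mulrnBl.
Qed.

Lemma rank_multiples0 n : (forall x : G, x *+ n = 0) -> rank (multiples G n) = set0.
Proof.
move=> n0; have m0 x : multiples G n x -> x = 0 by case=> y _ <-.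
have sm := subgroup_multiples n.
have F0 : free_rank (multiples G n) = set0.
  have [BS iB _] := free_rank_max (multiples G n).
  by apply: (@independent_torsion 0) => // x /BS /m0.
have T0 : sum_p_rank (multiples G n) = set0.
  apply/seteqP; split=> // -[p x] [/= pp px].
  have [ip pE] := p_rank_basis pp sm.
  suff p0 : p_rank p (multiples G n) = set0 by rewrite p0 in px.
  apply: (@independent_torsion p) => //; first by case: p pp {px ip pE} => [|[]].
  by move=> y py; have := @sub_span _ _ y py; rewrite pE => -[/m0].
by rewrite /rank /card_max F0 T0 card_ge0 image_set0.
Qed.

End RankLemmas.

(** * The torsion-free quotient and its lattices *)

Section TorsionFreeQuotient.
Variable G : zmodType.
Local Notation H := (Quotient.quot (torsion G)).
Local Notation pi := (quot_map (torsion G)).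

Lemma torsionP (x : G) : x \in torsion G <-> torsion_mod [set 0] x.
Proof. by split=> [/asboolP//|tx]; apply/asboolP. Qed.

Lemma quot_torsion_free (y : H) n : (0 < n)%N -> y *+ n = 0 -> y = 0.
Proof.
move=> n0; have [x <-] := quot_map_surj y; rewrite -raddfMn => /quot_map_eq0.
move=> /torsionP[k k0 /= xk]; apply/quot_map_eq0/torsionP; exists (n * k)%N.
  by rewrite muln_gt0 n0.
by rewrite /= mulrnA.
Qed.

Lemma torsion_mod_quot (b : seq G) :
  (forall x : G, torsion_mod (span [set` b]) x) ->
  forall y : H, torsion_mod (span [set` map pi b]) y.
Proof.
move=> tb y; have [x <-] := quot_map_surj y; have [k k0 bk] := tb x.
exists k => //; rewrite -raddfMn.
have : forall z, span [set` b] z -> span [set` map pi b] (pi z).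
  apply: (span_min (subgroup_preimage pi (subgroup_span _))) => z zb.
  by apply: sub_span; rewrite /= map_f.
exact.
Qed.

Lemma countable_lattice (bh : seq H) : (forall y : H, torsion_mod (span [set` bh]) y) ->
  countable [set: H].
Proof.
move=> tbh; apply: (@countable_torsion_mod _ _ (span [set` bh])) => //.
  by apply: countable_span; exact/finite_set_countable/finite_seq.
move=> n n0; apply: (@sub_countable _ _ _ [set 0]); last exact: countable1.
by apply: subset_card_le => y [_ /= /quot_torsion_free]; exact.
Qed.

(* [A/pA] is finite because [A] has finite socles. *)
Lemma finite_lattice_socle (A : zmodClosed H) (bh : seq H) p : prime p ->
  [set` A] = span [set` bh] ->
  finite_set [set y : Quotient.quot A | y *+ p = 0].
Proof.
move=> pp Abh; have sA := subgroup_zmodClosed A.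
pose pA : set H := (fun y => y *+ p) @` [set` A].
have spA : subgroup pA.
  split; first by exists 0; [exact: subgroup0|rewrite mul0rn].
  move=> _ _ [x Ax <-] [y Ay <-]; exists (x - y); last by rewrite mulrnBl.
  exact: (subgroupB sA).
have [s sP] := finite_socles_span bh spA.
(* A [p]-th part of [y] modulo [pA]. If [x *+ p] is congruent to [y], then [x - r y] is in [A]
   because [H] is torsion-free. *)
pose r y := xget 0 [set x : H | pA (x *+ p - y)].
apply: (@sub_finite_set _ _ [set` map (fun y => quot_map A (r y)) s]) => // q /= qp.
have [x xq] := quot_map_surj q; have Axp : x *+ p \in A.
  by apply/quot_map_eq0; rewrite raddfMn /= xq.
have [||y ys pAy] := sP (x *+ p) p _ pp; [by rewrite -Abh|by exists (x *+ p)|].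
have [a Aa aE] : pA (r y *+ p - y) by exact: (@xgetI _ _ [set z : H | pA (z *+ p - y)] x).
apply/mapP; exists y => //; rewrite -xq; apply/eqP; rewrite -subr_eq0 -raddfB.
apply/eqP/quot_map_eq0; case: pAy => a' Aa' a'E.
have -> : x - r y = a' - a; last exact: (subgroupB sA).
apply/eqP; rewrite -subr_eq0; apply/eqP; apply: (quot_torsion_free (prime_gt0 pp)).
rewrite !mulrnBl a'E aE.
have -> : x *+ p - y - (r y *+ p - y) = x *+ p - r y *+ p by rewrite opprB addrA subrK.
exact: subrr.
Qed.

(** Each prime contributes only finitely many elements by [finite_lattice_socle], so infinitely many
    primes contribute. *)
Lemma infinite_primes (A : zmodClosed H) (bh : seq H) :
  [set` A] = span [set` bh] -> infinite_set (sum_p_rank [set: Quotient.quot A]) ->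
  forall N, exists p, [/\ (N < p)%N, prime p & exists2 x, x *+ p \in A & x \notin A].
Proof.
move=> Abh infA N; apply: contrapT => noN; apply: infA.
apply: (@sub_finite_set _ _ (\bigcup_(p in `I_N.+1 `&` [set p | prime p])
   (pair p @` [set y : Quotient.quot A | y *+ p = 0]))); last first.
  apply: bigcup_finite; first by apply: finite_setIl; exact: finite_II.
  by move=> p [_ /= pp]; apply: finite_image; exact: finite_lattice_socle Abh.
move=> [p y] [/= pp py]; have [ip pE] := @p_rank_basis _ p [set: Quotient.quot A] pp (subgroup_setT _).
have := @sub_span _ _ y py; rewrite pE => -[_ /= yp].
exists p; last by exists y.
split => //=; rewrite ltnS leqNgt; apply/negP => Np; apply: noN; exists p; split => //.
have [x xy] := quot_map_surj y; exists x.
  by apply/quot_map_eq0; rewrite raddfMn /= xy.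
apply/negP => /quot_map_eq0; rewrite xy => y0.
have : independent p [set y].
  move=> s c us sy; apply: ip us _ => z /sy ->; exact: py.
move=> /(@independent_torsion _ p [set y]) B0.
suff : [set y] = set0 by move/seteqP => -[/(_ y erefl)].
apply: B0 => [|z ->//]; by case: p pp {py ip pE yp Np} => [|[]].
Qed.

End TorsionFreeQuotient.

(** Together with [unit_well_order], this provides the ordinals [0] and [1]. *)
Lemma void_well_order : wochoice.well_order (fun _ _ : void => true).
Proof. by move=> A [[]]. Qed.

Lemma unit_well_order : wochoice.well_order (fun _ _ : unit => true).
Proof.
move=> A [[] At]; exists tt; split; last by case.
by split => // -[].
Qed.

Lemma SSGP_SSGP_ord (G : topologicalZmodType) : SSGP G -> SSGP_ord (Ord unit_well_order) G.
Proof.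
move=> sG; apply: SSGP_ord_pos => [|U nU]; first exact: inhabits tt.
exists (Ord void_well_order); split.
  exists (fun v : void => match v return unit with end); first by case.
  exists tt; apply/seteqP; split; first by move=> _ [[]].
  by move=> [] [].
apply: SSGP_ord_zero; first by case; case.
move=> q; rewrite -(topquot_mapK q); apply/topquot_map_eq0; rewrite inE /=.
move=> B; rewrite nbhsE => -[O [oO Ox] OB].
have [y [Oy Sy]] := sG U nU O (ex_intro _ _ Ox) oO.
by exists y; split => //; exact: OB.
Qed.

(** * Groups whose multiples by [n] have finite rank *)

Section MainTheorem.
Variable G : zmodType.
Local Notation H := (Quotient.quot (torsion G)).
Local Notation pi := (quot_map (torsion G)).
Variables (n : nat) (b : seq G).
Hypothesis n_gt0 : (0 < n)%N.
Hypothesis tb : forall x : G, torsion_mod (span [set` b]) x.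
Hypothesis fin_torsion : forall p, prime p -> finite_set (ntorsion (multiples G n) p).
Variable ps : seq nat.
Hypothesis no_torsion : forall p x,
  prime p -> p \notin ps -> multiples G n x -> x *+ p = 0 -> x = 0.

Lemma countable_multiples : countable (multiples G n).
Proof.
apply: (@countable_torsion_mod _ _ (span [set` b])) => //.
- exact: subgroup_multiples.
- by apply: countable_span; exact/finite_set_countable/finite_seq.
- move=> k k0; apply: finite_set_countable.
  by apply: finite_ntorsion => //; exact: subgroup_multiples.
Qed.

(** An extension: the image in [H] inherits finite socles, and the torsion part has them by
    [finite_socles_torsion]. *)
Lemma finite_socles_multiples : finite_socles [set: H] -> finite_socles (multiples G n).
Proof.
have sM := subgroup_multiples G n.
move=> fH; apply: (@finite_socles_ext _ _ pi) => //.
  exact: finite_socles_sub _ fH.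
apply: (@finite_socles_torsion _ _ ps).
- by apply: (subgroupI sM); exact: (subgroup_preimage pi (@subgroup_set0 H)).
- by move=> x [_ /= /quot_map_eq0 /torsionP].
- move=> p pp; apply: sub_finite_set (fin_torsion pp) => x [[Mx _] xp]; split => //.
- by move=> p x pp pps [Mx _]; exact: no_torsion.
Qed.

(** Torsion-free of finite rank, [H] is countable, and so are its quotients; an infinite rank is
    therefore the first infinite cardinal. *)
Lemma infinite_rank (A : zmodClosed H) : is_torsion (Quotient.quot A) ->
  (infinite_set (sum_p_rank [set: Quotient.quot A]) <->
   rank [set: Quotient.quot A] #= [set: nat]).
Proof.
move=> tA; rewrite (card_eql (rank_torsion tA)).
split=> [infA|E].
  apply: eq_card_nat => //; apply: (@sub_countable _ _ _ ([set: nat] `*` [set: Quotient.quot A])).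
    exact: subset_card_le.
  apply: countableX => //.
  have -> : [set: Quotient.quot A] = quot_map A @` [set: H].
    by apply/seteqP; split => // y _; have [x <-] := quot_map_surj y; exists x.
  by apply: countable_image; exact: (countable_lattice (torsion_mod_quot tb)).
by rewrite (eq_finite_set E); exact: infinite_nat.
Qed.

Lemma free_subgroup_seq (A : set H) : free_subgroup A ->
  exists bh : seq H, [/\ uniq bh, independent 0 [set` bh] & A = span [set` bh]].
Proof.
move=> [B [iB <-]].
have /finite_seqP[s sE] : finite_set B by apply: indep_finite iB _ => x _; exact: (torsion_mod_quot tb).
exists (undup s); rewrite undup_uniq.
have -> : [set` undup s] = [set` s] by apply/seteqP; split => x /=; rewrite mem_undup.
by rewrite -sE.
Qed.

(* The basis of [A] is lifted to [G] and multiplied by [n]: the lattice [A'] that *)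
(* it spans lies in [nG], hence in every [S0] left over by the decomposition. *)
Lemma lattice_SSGP (A : zmodClosed H) : free_subgroup [set` A] ->
  is_torsion (Quotient.quot A) -> infinite_set (sum_p_rank [set: Quotient.quot A]) ->
  admits_SSGP G.
Proof.
move=> /free_subgroup_seq[bh [ubh ibh Abh]] tA infA.
pose v (y : H) : G := repr y *+ n.
have piv y : pi (v y) = y *+ n by rewrite raddfMn; congr (_ *+ _); exact: reprK.
pose A' := span (v @` [set` bh]); have sA' : subgroup A' := subgroup_span _.
have iv : indep_mod v [set 0] 0 [set` bh].
  move=> s c us sb /= E i si.
  have /(_ i si) : {in s, forall i, (0 %| c i * n%:Z)%Z}.
    apply: (ibh s (fun i => c i * n%:Z)) => //.
    have := congr1 pi E; rewrite raddf0 /lincomb raddf_sum /= => E'; rewrite -[RHS]E'.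
    apply: eq_bigr => j _; rewrite raddfMz /= piv pmulrn -!mulrzA.
    by rewrite mulrC.
  by rewrite !dvd0z mulf_eq0 => /orP[//|]; lia.
have A'M : A' `<=` multiples G n.
  apply: span_min; first exact: subgroup_multiples.
  by move=> _ [y _ <-]; exists (repr y).
have piA' x : A' x -> exists2 a, a \in A & pi x = a *+ n.
  move: x; apply: span_min.
    split; first by exists 0; rewrite ?rpred0 // raddf0 mul0rn.
    move=> x y [a Aa xa] [a' Aa' ya']; exists (a - a'); rewrite ?rpredB //.
    by rewrite raddfB /= xa ya' mulrnBl.
  move=> _ [y yb <-]; exists y => //.
  have : span [set` bh] y by exact: sub_span.
  by rewrite -Abh.
have liftA a : a \in A -> exists2 w, A' w & pi w = a *+ n.
  move=> Aa; have : span [set` bh] a by rewrite -Abh.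
  move: a {Aa}; apply: span_min.
    split; first by exists 0; [exact: subgroup0|rewrite raddf0 mul0rn].
    move=> x y [w Aw xw] [w' Aw' yw']; exists (w - w'); first exact: (subgroupB sA').
    by rewrite raddfB /= xw yw' mulrnBl.
  by move=> y yb; exists (v y); [apply: sub_span; exists y|exact: piv].
have decomp x : pi x \in A -> exists2 w, A' w & x *+ n - w \in torsion G.
  move=> /liftA[w Aw wE]; exists w => //; apply/quot_map_eq0.
  by rewrite raddfB /= raddfMn /= wE subrr.
have tA' x : torsion_mod A' x.
  have [y yx] := quot_map_surj (quot_map A (pi x)).
  have /asboolP[k k0 kx] := tA (quot_map A (pi x)).
  have : pi (x *+ k) \in A.
    by apply/quot_map_eq0; rewrite raddfMn /= raddfMn.
  move=> /decomp[w Aw /torsionP[l l0 /= wl]]; exists (k * (n * l))%N.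
    by rewrite !muln_gt0 k0 n_gt0 l0.
  move: wl; rewrite mulrnBl => /eqP; rewrite subr_eq0 -!mulrnA => /eqP ->.
  exact: (subgroupMn sA').
have [bU bUP] : has_SSGP_base [set: G]; last exact: (base_admits_SSGP bUP).
apply: (SSGP_base_decomposition n_gt0 (subgroup_setT G)).
  exact: countable_multiples.
move=> S0 sS0 cS0 _ MS0'.
have MS0 : multiples G n `<=` S0 by move=> _ [x _ <-]; exact: MS0'.
apply: (@countable_SSGP_base _ S0 _ v bh) => //.
(* Taking [p] beyond [n] and all of [ps] makes it prime to [n] and excludes [p]-torsion from [G]. *)
move=> N; have [p [Np pp [x Apx nAx]]] := infinite_primes Abh infA
  (maxn N (maxn n (\max_(i <- ps) i))).
move: Np; rewrite !gtn_max => /and3P[Np np psp].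
have pps : p \notin ps.
  apply/negP => pps; move: psp; rewrite ltnNge => /negP; apply.
  exact: (@leq_bigmax_seq _ ps xpredT id).
have pn : coprime p n.
  by rewrite prime_coprime // gtnNdvd.
have no_ptorsion (t : G) : t *+ p = 0 -> t = 0.
  move=> tp; apply: (@subgroup_coprime _ [set 0] t p n) => //; first exact: subgroup_set0.
  apply: (no_torsion pp pps); first by exists t.
  by rewrite -mulrnA mulnC mulrnA tp mul0rn.
pose g := repr x : G; have pig : pi g = x by exact: reprK.
have [w Aw] : exists2 w, A' w & g *+ p *+ n - w \in torsion G.
  by apply: decomp; rewrite raddfMn /= pig.
set t := _ - w => /torsionP tt.
(* The torsion error [t] has order [k] prime to [p], so multiplication by [k] removes it and
   preserves order [p] modulo the lattice. *)
have ext : exists k, (0 < k)%N && (t *+ k == 0).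
  by have [k k0 /= tk] := tt; exists k; rewrite k0 tk eqxx.
case: (ex_minnP ext) => k /andP[k0 /eqP tk] kmin.
have pk : coprime p k.
  rewrite prime_coprime //; apply/negP => pk.
  have : (k %/ p < k)%N by rewrite ltn_Pdiv // prime_gt1.
  rewrite ltnNge => /negP; apply; apply: kmin.
  rewrite divn_gt0 ?prime_gt0 // dvdn_leq //=; apply/eqP; apply: no_ptorsion.
  by rewrite -mulrnA divnK.
exists p; split => //; exists (g *+ n *+ k); split.
- by apply: (subgroupMn sS0); apply: MS0; exists g.
- have -> : g *+ n *+ k *+ p = w *+ k.
    apply/eqP; rewrite -subr_eq0; apply/eqP; rewrite -[RHS]tk /t mulrnBl.
    by congr (_ - _); rewrite -!mulrnA; congr (_ *+ _); lia.
  exact: (subgroupMn sA').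
(* Torsion-freeness cancels [n], so [x *+ k] would be in [A]; together with [x *+ p] this would put
   [x] in [A]. *)
move=> /piA'[a Aa]; rewrite raddfMn /= raddfMn /= pig => E.
case/negP: nAx; have sA := subgroup_zmodClosed A.
apply: (@subgroup_coprime _ [set` A] x p k sA) => //=.
suff -> : x *+ k = a by [].
apply/eqP; rewrite -subr_eq0; apply/eqP; apply: (quot_torsion_free n_gt0).
by rewrite mulrnBl -E -!mulrnA mulnC subrr.
Qed.

End MainTheorem.

Lemma divisible_rank_index (G : zmodType) :
  `I_1 #<= divisible_rank G -> finite_set (divisible_rank G) ->
  exists n, [/\ (0 < n)%N, finite_set (rank (multiples G n)) &
    ~ forall x : G, x *+ n = 0].
Proof.
rewrite /divisible_rank; set m := xget _ _ => ge1 fin.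
(* The default value of [xget] is positive too. *)
have gt0 : (0 < m)%N by rewrite /m; case: xgetP => [k _ []|].
exists m; split => // n0.
move: ge1; rewrite rank_multiples0 // card_le0 => /eqP E.
by have : `I_1 0%N by []; rewrite E.
Qed.

Theorem theorem4p1 (G : zmodType)
    (rd_ge1 : `I_1 #<= divisible_rank G)
    (rd_fin : finite_set (divisible_rank G)) :
  let H : zmodType := Quotient.quot (torsion G) in
  [<-> admits_SSGP G;
       exists alpha : ord, admits_SSGP_ord alpha G;
       finite_set (free_rank [set: H]) /\
         exists A : zmodClosed H,
           [/\ free_subgroup [set` A], is_torsion (Quotient.quot A) &
               rank [set: Quotient.quot A] #= [set: nat]];
       finite_set (free_rank [set: H]) /\
         forall A : zmodClosed H,
           free_subgroup [set` A] -> is_torsion (Quotient.quot A) ->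
           rank [set: Quotient.quot A] #= [set: nat]].
Proof.
move=> H; have [n [n0 finn nG]] := divisible_rank_index rd_ge1 rd_fin.
have [fin0 finp] := finite_card_max finn.
have [ftor [ps no_tor]] := finite_sum_p_rank (subgroup_multiples G n) finp.
have maxn := free_rank_max (multiples G n).
have [b [ub bE ib]] := max_indep_finite maxn fin0.
have tb (x : G) : torsion_mod (span [set` b]) x.
  have [|k k0 bk] := max_indep_torsion maxn (x := x *+ n); first by exists x.
  by exists (n * k)%N; [rewrite muln_gt0 n0|rewrite mulrnA -bE].
have maxH := free_rank_max [set: H].
have finH : finite_set (free_rank [set: H]).
  by case: maxH => _ iB _; apply: indep_finite iB _ => y _; exact: (torsion_mod_quot tb).
(* A concrete lattice proves the existential form of (iii) and is the one to which its universal
   form is applied. *)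
pose A0 : zmodClosed H := subgroup_mem (subgroup_span (free_rank [set: H])).
have A0E : [set` A0] = span (free_rank [set: H]).
  by apply/seteqP; split => y Ay; apply/(subgroup_memE (subgroup_span (free_rank [set: H]))).
have fA0 : free_subgroup [set` A0].
  by rewrite A0E; exists (free_rank [set: H]); split => //; case: maxH.
have tA0 : is_torsion (Quotient.quot A0).
  move=> q; have [y <-] := quot_map_surj q; apply/torsionP.
  have [k k0 yk] := max_indep_torsion maxH (I : [set: H] y); exists k => //=.
  by rewrite -raddfMn; apply/quot_map_eq0/subgroup_memE.
tfae.
- by move=> [tau sG]; exists (Ord unit_well_order), tau; exact: SSGP_SSGP_ord.
- move=> [alpha hG]; split => //; exists A0; split => //.
  apply/(infinite_rank tb tA0) => fA; apply: nG; apply: (SSGP_ord_multiples hG tb).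
  apply: (finite_socles_multiples ftor no_tor).
  have [bh [_ _ A0bh]] := free_subgroup_seq tb fA0.
  exact/(finite_socles_lattice A0bh tA0).
- move=> [_ [A [fA tA rA]]]; split => // A' fA' tA'.
  apply/(infinite_rank tb tA') => finA'.
  have [bh [_ _ Abh]] := free_subgroup_seq tb fA.
  have [bh' [_ _ Abh']] := free_subgroup_seq tb fA'.
  move/(infinite_rank tb tA): rA; apply; apply/(finite_socles_lattice Abh tA).
  exact/(finite_socles_lattice Abh' tA').
- move=> [_ /(_ A0 fA0 tA0) rA].
  apply: (lattice_SSGP n0 tb ftor no_tor fA0 tA0).
  exact/(infinite_rank tb tA0).
Qed.
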